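(* There is an absolute constant $C>0$ such that the following holds. Let $\mathcal A\subseteq S_n$ with $|\mathcal A|=c\,n!$, where $0<c<1$, and let $\delta_0\ge 0$. If $|\partial\mathcal A|\le (1-c+\delta_0)\,n\,|\mathcal A|$, then there exists a dictatorship $\mathcal B\subseteq S_n$ with \[\frac{|\mathcal A\triangle\mathcal B|}{n!}\le \frac{C}{c(1-c)}\left((c\delta_0)^{1/7}+\frac{1}{n^{1/3}}\right).\]
   Context: $S_n$ is the symmetric group on $[n]$. The transposition graph is the Cayley graph on $S_n$ generated by the transpositions: $\sigma,\tau$ are adjacent iff $\sigma\tau^{-1}$ is a transposition. For $\mathcal A\subseteq S_n$, $\partial\mathcal A$ is the set of edges of this graph with exactly one endpoint in $\mathcal A$. For $i,j\in[n]$, $T_{ij}=\{\pi\in S_n:\pi(i)=j\}$. A dictatorship is a subset of $S_n$ that is a union of pairwise disjoint sets $T_{ij}$ (equivalently, a set determined by the image of a single element or by the pre-image of a single element). *)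

(* Defs.v *)
From Stdlib Require Import Reals.
From mathcomp Require Import all_boot all_fingroup.
Set Implicit Arguments. Unset Strict Implicit. Unset Printing Implicit Defensive.

Local Open Scope group_scope.

Definition is_transposition n (s : {perm 'I_n}) : Prop :=
  exists i j : 'I_n, i != j /\ s = tperm i j.

(* Edge boundary of A in the transposition graph: each edge {sigma,tau} with
   exactly one endpoint in A is counted once, as the ordered pair
   (endpoint in A, endpoint outside A). *)
Definition boundary_edges n (A : {set {perm 'I_n}}) : {set {perm 'I_n} * {perm 'I_n}} :=
  [set p | [&& p.1 \in A, p.2 \notin A &
     [exists i : 'I_n, exists j : 'I_n, (i != j) && (p.1 * p.2^-1 == tperm i j)]]].

Definition Tset n (i j : 'I_n) : {set {perm 'I_n}} := [set s : {perm 'I_n} | s i == j].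

Definition dictatorship n (B : {set {perm 'I_n}}) : Prop :=
  exists F : {set 'I_n * 'I_n},
    (forall p q, p \in F -> q \in F -> p != q -> [disjoint Tset p.1 p.2 & Tset q.1 q.2]) /\
    B = \bigcup_(p in F) Tset p.1 p.2.

Definition symdiff (T : finType) (A B : {set T}) : {set T} := (A :\: B) :|: (B :\: A).

(* Real power x^y for x >= 0, with 0^y = 0 (y > 0 in all uses). *)
Definition rpow (x y : R) : R := (if Rle_dec x 0 then R0 else Rpower x y).

(* Main.v *)
(** Write f for the indicator of A and L for the Laplacian of the transposition graph, and split
    f = c + h + f', where h(p) = sum_i b(i, p(i)) with b doubly centred, and c + h is the projection
    of f on the span of the T_ij.  On that span L h = n h, while L >= 2(n-1) on its orthogonal
    complement: if e is an eigenvector there, take a maximal set S of positions such that the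
    average g of e over Sym(S) is nonzero; maximality turns the part of L g that involves a position
    outside S into an explicit multiple of g.  Comparing with the edge boundary gives
    |f'|^2 = O(c delta0).

    Now take a set S of positions and randomise a permutation on S and on its complement
    independently.  Then h = X + Y with X, Y independent, and since f is Boolean and close to h,
    comparing f at the four corners (X,Y), (X',Y), (X,Y'), (X',Y') forces Var X Var Y = O(|f'|^2).
    Averaging over S and over the starting permutation bounds the sum of b(i,x)^2 b(k,y)^2 over
    i <> k, x <> y by O(n^2 |f'|^2 + n).  As b^2 <= 1 has total mass of order n c(1-c), almost
    all the mass lies in one row or one column of b, so f is close to a function of p(i) or of
    p^-1(j), which is rounded to a dictatorship. *)

Require Import Defs.
From Stdlib Require Import Reals Lra.
From mathcomp Require Import all_boot all_order all_fingroup all_algebra.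
From mathcomp Require ring lra zify complex Rstruct.
Set Implicit Arguments. Unset Strict Implicit. Unset Printing Implicit Defensive.

Module LevelOne.
Import Order.TTheory GRing.Theory Num.Theory complex ring lra zify.
Local Open Scope ring_scope.

(** * Spectral gap of the transposition graph *)

(** Diagonalise [K] over the complex closure by a unitary matrix. The coordinates of [v] along
    eigenvalues below [k] vanish, so only eigenvalues at least [k] enter the quadratic form. *)
Lemma rayleigh_ge (R : rcfType) N (K : 'M[R]_N) (v : 'rV[R]_N) (k : R) :
  K^T = K ->
  (forall (e : 'rV[R]_N) nu, nu < k -> e *m K = nu *: e -> v *m e^T = 0) ->
  k * (v *m v^T) 0 0 <= (v *m K *m v^T) 0 0.
Proof.
move=> Ksym Korth.
pose A := map_mx (real_complex R) K; pose w := map_mx (real_complex R) v.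
have ReD : {morph (@complex.Re R) : x y / x + y} by move=> [? ?] [? ?].
have ImD : {morph (@complex.Im R) : x y / x + y} by move=> [? ?] [? ?].
have Aherm : A \is hermsymmx.
  apply: realsym_hermsym.
    by apply/is_hermitianmxP; rewrite expr0 scale1r map_mx_id // /A map_trmx Ksym.
  by apply/mxOverP => i j; rewrite mxE; apply/complex_realP; exists (K i j).
have /orthomx_spectralP := hermitian_normalmx Aherm.
have dreal := hermitian_spectral_diag_real Aherm.
set P := spectralmx A; set d := spectral_diag A.
have Pu : P \is unitarymx := spectral_unitarymx A.
have Punit := unitarymx_unit Pu.
have dE j : d 0 j = (complex.Re (d 0 j))%:C%C.
  by rewrite RRe_real //; move/mxOverP: dreal => /(_ 0 j).
move=> Aspec.
have PA : P *m A = diag_mx d *m P by rewrite {1}Aspec !mulmxA mulmxV // mul1mx.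
pose c := w *m (P ^t*)%sesqui.
have wE : w = c *m P.
  by rewrite /c -mulmxA -(invmx_unitary Pu) mulVmx // mulmx1.
have wconj : (w ^t*)%sesqui = w^T.
  by apply/matrixP => i j; rewrite !mxE conj_Creal //; apply/complex_realP; exists (v j i).
have cconj : P *m w^T = (c ^t*)%sesqui.
  by rewrite -wconj /c trmx_mul map_mxM trmxCK.
have ww : w *m w^T = c *m (c ^t*)%sesqui by rewrite {1}wE -mulmxA cconj.
have wAw : w *m A *m w^T = c *m diag_mx d *m (c ^t*)%sesqui.
  by rewrite {1}wE -[c *m P *m A]mulmxA PA -!mulmxA cconj.
(* The real and imaginary parts [x], [y] of row [j] of [P] are real eigenvectors of [K], because its
   eigenvalue and the entries of [K] are real; [Korth] applies to each of them. *)
have c0 j : complex.Re (d 0 j) < k -> c 0 j = 0.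
  move=> djk.
  pose x : 'rV[R]_N := \row_l complex.Re (P j l).
  pose y : 'rV[R]_N := \row_l complex.Im (P j l).
  have PAj l : \sum_m P j m * (K m l)%:C%C = d 0 j * P j l.
    move/matrixP: PA => /(_ j l); rewrite mul_diag_mx !mxE => <-.
    by apply: eq_bigr => m _; rewrite !mxE.
  have xK : x *m K = complex.Re (d 0 j) *: x.
    apply/rowP => l; rewrite !mxE; move: (congr1 (@complex.Re R) (PAj l)).
    rewrite (big_morph (@complex.Re R) ReD (erefl _)) dE => H.
    have -> : complex.Re (d 0 j) * complex.Re (P j l) =
       complex.Re ((complex.Re (d 0 j))%:C%C * P j l) by case: (P j l) => a b /=; ring.
    rewrite -H; apply: eq_bigr => m _; rewrite !mxE.
    by case: (P j m) => a b /=; ring.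
  have yK : y *m K = complex.Re (d 0 j) *: y.
    apply/rowP => l; rewrite !mxE; move: (congr1 (@complex.Im R) (PAj l)).
    rewrite (big_morph (@complex.Im R) ImD (erefl _)) dE => H.
    have -> : complex.Re (d 0 j) * complex.Im (P j l) =
       complex.Im ((complex.Re (d 0 j))%:C%C * P j l) by case: (P j l) => a b /=; ring.
    rewrite -H; apply: eq_bigr => m _; rewrite !mxE.
    by case: (P j m) => a b /=; ring.
  have := Korth _ _ djk xK; move/matrixP/(_ 0 0); rewrite !mxE => vx0.
  have := Korth _ _ djk yK; move/matrixP/(_ 0 0); rewrite !mxE => vy0.
  rewrite /c; apply/eqP; rewrite eq_complex.
  rewrite (big_morph (@complex.Re R) ReD (erefl _)) (big_morph (@complex.Im R) ImD (erefl _)).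
  apply/andP; split; apply/eqP.
    rewrite [RHS]/= -vx0; apply: eq_bigr => m _; rewrite !mxE.
    by case: (P j m) => a b /=; ring.
  rewrite [RHS]/= -[RHS]oppr0 -vy0 -sumrN; apply: eq_bigr => m _; rewrite !mxE.
  by case: (P j m) => a b /=; ring.
rewrite -lecR rmorphM /=.
have -> : ((v *m v^T) 0 0)%:C%C = (w *m w^T) 0 0.
  by rewrite /w map_trmx -map_mxM [RHS]mxE.
have -> : ((v *m K *m v^T) 0 0)%:C%C = (w *m A *m w^T) 0 0.
  by rewrite /w map_trmx -!map_mxM [RHS]mxE.
rewrite ww wAw mul_mx_diag {ww wAw}; clearbody c.
rewrite !mxE mulr_sumr; apply: ler_sum => j _; rewrite !mxE.
case: (ltrP (complex.Re (d 0 j)) k) => [/c0 ->|]; first by rewrite !mul0r !mulr0.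
move=> kd; rewrite [_ * d 0 j]mulrC -mulrA dE; apply: ler_wpM2r; last by rewrite lecR.
by rewrite mul_conjC_ge0.
Qed.

Section SymmetricGroup.
Variables (R : rcfType) (n : nat).
Implicit Types (f g : {perm 'I_n} -> R) (p q s t : {perm 'I_n}) (S : {set 'I_n}) (i k l : 'I_n).

(* Each transposition occurs twice in the double sum; the terms with [i = k] vanish. *)
Definition lap f p : R := 2^-1 * \sum_i \sum_k (f p - f (tperm i k * p)%g).

Definition symsum S f p : R := \sum_(s | perm_on S s) f (s * p)%g.

Lemma sum_mull t f : \sum_p f (t * p)%g = \sum_p f p.
Proof. by rewrite [RHS](reindex_inj (mulgI t)). Qed.

Lemma tperm_on_set S i k : i \in S -> k \in S -> perm_on S (tperm i k).
Proof.
move=> iS kS; apply/subsetP => x; rewrite inE.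
by apply: contraNT => xS; rewrite tpermD //; apply: contraNneq xS => <-.
Qed.

Lemma perm_on_mull S t s : perm_on S t -> perm_on S (t * s)%g = perm_on S s.
Proof.
move=> tS; apply/idP/idP => [ts|]; last exact: perm_onM.
by rewrite -[s](mulKg t); apply: perm_onM => //; apply: perm_onV.
Qed.

Lemma perm_on_mulr S t s : perm_on S t -> perm_on S (s * t)%g = perm_on S s.
Proof.
move=> tS; apply/idP/idP => [ts|sS]; last exact: perm_onM.
by rewrite -[s](mulgK t); apply: perm_onM => //; apply: perm_onV.
Qed.

Lemma sum_sym_mull S t (F : {perm 'I_n} -> R) : perm_on S t ->
  \sum_(s | perm_on S s) F (t * s)%g = \sum_(s | perm_on S s) F s.
Proof.
move=> tS; rewrite [RHS](reindex_inj (mulgI t)).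
by apply: eq_bigl => s; rewrite perm_on_mull.
Qed.

Lemma sum_sym_mulr S t (F : {perm 'I_n} -> R) : perm_on S t ->
  \sum_(s | perm_on S s) F (s * t)%g = \sum_(s | perm_on S s) F s.
Proof.
move=> tS; rewrite [RHS](reindex_inj (mulIg t)).
by apply: eq_bigl => s; rewrite perm_on_mulr.
Qed.

Lemma sum_perm_on_cst S (c : R) : \sum_(s | perm_on S s) c = (#|S|`!)%:R * c.
Proof. by rewrite sumr_const card_perm mulr_natl. Qed.

Lemma symsum_inv S f t p : perm_on S t -> symsum S f (t * p)%g = symsum S f p.
Proof.
move=> tS; rewrite /symsum -(sum_sym_mulr (fun s => f (s * p)%g) tS).
by apply: eq_bigr => s _; rewrite mulgA.
Qed.

(** The Laplacian sums over the whole conjugacy class of transpositions, so it commutes with left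
    translation by each [s]; reindexing [i] and [k] by [s^-1] performs the conjugation. *)
Lemma symsum_lap S f p : symsum S (lap f) p = lap (symsum S f) p.
Proof.
rewrite /symsum /lap -mulr_sumr; congr (_ * _).
transitivity (\sum_(s | perm_on S s) \sum_i \sum_k (f (s * p)%g - f (s * (tperm i k * p))%g)).
  apply: eq_bigr => s _; rewrite (reindex_inj (@perm_inj _ s^-1)) /=; apply: eq_bigr => i _.
  rewrite (reindex_inj (@perm_inj _ s^-1)) /=; apply: eq_bigr => k _; congr (_ - f _).
  by rewrite -[in RHS](permKV s i) -[in RHS](permKV s k) -tpermJ /conjg !mulgA mulgV mul1g.
rewrite exchange_big; apply: eq_bigr => i _; rewrite exchange_big; apply: eq_bigr => k _.
by rewrite sumrB.
Qed.

Lemma sum_sqr_sub_tperm f i k :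
  2 * (\sum_p f p * (f p - f (tperm i k * p)%g)) = \sum_p (f p - f (tperm i k * p)%g) ^+ 2.
Proof.
have E : \sum_p f (tperm i k * p)%g ^+ 2 = \sum_p f p ^+ 2 by rewrite (sum_mull _ (fun p => f p ^+ 2)).
under [RHS]eq_bigr => p _ do rewrite sqrrB.
rewrite big_split sumrB /= E.
under eq_bigr => p _ do rewrite mulrBr -expr2.
rewrite sumrB sumrMnl mulr2n; ring.
Qed.

(* Cosets of [Sym S] in [Sym (i |: S)]: [s] sends [i] to [l] iff [s = s' * tperm i l] with [s'] fixing [i]. *)
Lemma symsumU1 S f i p : i \notin S ->
  symsum (i |: S) f p = \sum_(l in i |: S) symsum S f (tperm i l * p)%g.
Proof.
move=> iS; rewrite /symsum (partition_big (fun s : {perm 'I_n} => s i) (mem (i |: S))) /=; last first.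
  by move=> s sS; rewrite perm_closed // setU11.
have iU : i \in i |: S by rewrite setU11.
apply: eq_bigr => l lS; rewrite (reindex_inj (mulIg (tperm i l))) /=.
apply: eq_big => [s|s _]; last by rewrite mulgA.
rewrite perm_on_mulr ?tperm_on_set // permM.
apply/andP/idP => [[sU /eqP sl]|sS].
  have si : s i = i by apply: (@perm_inj _ (tperm i l)); rewrite sl tpermL.
  apply/subsetP => x xs; have := subsetP sU x xs; rewrite !inE in xs *.
  by case/orP => // /eqP xi; rewrite xi si eqxx in xs.
split; last by rewrite (out_perm sS iS) tpermL.
by apply: subset_trans sS _; apply: subsetU1.
Qed.

(** Let [S] be of maximal size [s] with [g = symsum S f] nonzero. Pairs inside [S] contribute
    nothing to [lap g], mixed pairs contribute exactly [(n - s)(s + 1) g], and pairs outside [S]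
    give a nonnegative form when paired with [g]. Hence [nu] is at least [(n - s)(s + 1)]. *)
Lemma lap_eigen_ge f nu :
  (forall p, lap f p = nu * f p) ->
  (forall S, (n.-1 <= #|S|)%N -> forall p, symsum S f p = 0) ->
  (exists p, f p != 0) -> (n.-1 * 2)%:R <= nu.
Proof.
move=> Lf Vf [p0 fp0].
pose P (S : {set 'I_n}) := [exists p, symsum S f p != 0].
have perm1 S : (#|S| <= 1)%N -> P S.
  move=> S1; apply/existsP; exists p0; rewrite /symsum (big_pred1 1%g) ?mul1g // => s.
  by apply/idP/eqP => [/perm_on_id/(_ S1)|->]; last exact: perm_on1.
have P0 : P set0 by apply: perm1; rewrite cards0.
case: (arg_maxnP (fun S : {set 'I_n} => #|S|) P0) => S PS Smax.
have Slt : (#|S| < n.-1)%N.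
  rewrite ltnNge; apply/negP => /Vf VS; case/existsP: PS => p.
  by rewrite VS eqxx.
have S1 : (1 <= #|S|)%N.
  have i0 : 'I_n by apply: (@Ordinal _ 0); lia.
  have := Smax [set i0]; rewrite cards1; apply; apply: perm1; by rewrite cards1.
pose g := symsum S f.
have gt i k p : i \in S -> k \in S -> g (tperm i k * p)%g = g p.
  by move=> iS kS; apply: symsum_inv; apply: tperm_on_set.
(* By maximality the sum over the symmetric group of [i |: S] vanishes; in its coset decomposition
   the coset [l = i] contributes [g p] itself. *)
have gz i p : i \notin S -> \sum_(l in S) g (tperm i l * p)%g = - g p.
  move=> iS; have /negbTE : ~~ P (i |: S).
    by apply/negP => /Smax; rewrite cardsU1 iS /=; lia.
  move/existsPn/(_ p)/negPn/eqP; rewrite symsumU1 // big_setU1 //= tperm1 mul1g.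
  by move/eqP; rewrite addrC addr_eq0 => /eqP.
have Lg p : lap g p = nu * g p.
  by rewrite -symsum_lap /symsum mulr_sumr; apply: eq_bigr => s _; rewrite Lf.
have sumS i p : i \notin S -> \sum_(k in S) (g p - g (tperm i k * p)%g) = (#|S|.+1)%:R * g p.
  by move=> iS; rewrite sumrB gz // sumr_const opprK -natr1 mulrDl mul1r mulr_natl.
have lapE p : lap g p = (#|~: S| * #|S|.+1)%:R * g p
    + 2^-1 * \sum_(i in ~: S) \sum_(k in ~: S) (g p - g (tperm i k * p)%g).
  have split2 (F : 'I_n -> R) : \sum_i F i = \sum_(i in S) F i + \sum_(i in ~: S) F i.
    by rewrite (bigID (mem S)) /=; congr (_ + _); apply: eq_bigl => i; rewrite inE.
  have cross i : i \in ~: S -> \sum_(k in S) (g p - g (tperm i k * p)%g) = (#|S|.+1)%:R * g p.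
    by rewrite inE; apply: sumS.
  rewrite /lap split2.
  under eq_bigr => i _ do rewrite split2.
  under [X in _ + X]eq_bigr => i _ do rewrite split2.
  rewrite !big_split /=.
  have -> : \sum_(i in S) \sum_(k in S) (g p - g (tperm i k * p)%g) = 0.
    by apply: big1 => i iS; apply: big1 => k kS; rewrite gt // subrr.
  have crossE : \sum_(i in ~: S) \sum_(k in S) (g p - g (tperm i k * p)%g) =
            (#|~: S| * #|S|.+1)%:R * g p.
    by rewrite (eq_bigr _ cross) sumr_const natrM -mulrA [in RHS]mulr_natl.
  have -> : \sum_(i in S) \sum_(k in ~: S) (g p - g (tperm i k * p)%g) =
            (#|~: S| * #|S|.+1)%:R * g p.
    rewrite -crossE exchange_big /=; apply: eq_bigr => i _; apply: eq_bigr => k _.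
    by rewrite tpermC.
  by rewrite crossE; field.
case/existsP: PS => q gq.
have gg : 0 < \sum_p g p ^+ 2.
  rewrite (bigD1 q) //=; apply: ltr_pwDl; last by apply: sumr_ge0 => p _; apply: sqr_ge0.
  by rewrite exprn_even_gt0.
rewrite -(ler_pM2r gg).
have -> : nu * \sum_p g p ^+ 2 = \sum_p g p * lap g p.
  by rewrite mulr_sumr; apply: eq_bigr => p _; rewrite Lg; ring.
have -> : \sum_p g p * lap g p = (#|~: S| * #|S|.+1)%:R * (\sum_p g p ^+ 2) +
    4^-1 * \sum_(i in ~: S) \sum_(k in ~: S) \sum_p (g p - g (tperm i k * p)%g) ^+ 2.
  under eq_bigr => p _ do rewrite lapE mulrDr.
  rewrite big_split /= mulr_sumr; congr (_ + _); first by apply: eq_bigr => p _; ring.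
  under eq_bigr => p _ do rewrite mulrCA mulr_sumr.
  rewrite -mulr_sumr exchange_big /=.
  have -> : 4^-1 = 2^-1 * 2^-1 :> R by field.
  rewrite -mulrA; congr (_ * _); rewrite mulr_sumr; apply: eq_bigr => i _.
  under eq_bigr => p _ do rewrite mulr_sumr.
  rewrite exchange_big mulr_sumr /=; apply: eq_bigr => k _.
  by rewrite -sum_sqr_sub_tperm mulrA mulVf ?mul1r // pnatr_eq0.
rewrite -[X in X <= _]addr0; apply: lerD.
  rewrite ler_pM2r // ler_nat.
  (* [(n - s)(s + 1)] is concave in [s] and equals [2(n - 1)] at both ends of the range
     [1 <= s <= n - 2]. *)
  have := cardsC S; rewrite card_ord => nE.
  move: Slt S1 nE; move: #|S| #|~: S| => a b; nia.
rewrite mulr_ge0 ?invr_ge0 ?ler0n //; apply: sumr_ge0 => i _; apply: sumr_ge0 => k _.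
by apply: sumr_ge0 => p _; apply: sqr_ge0.
Qed.

End SymmetricGroup.

(** * Projection onto the span of the T_ij, and the spectral gap on its complement *)

Section Projection.
Variables (R : rcfType) (n : nat).
Implicit Types (f g : {perm 'I_n} -> R) (p q s t : {perm 'I_n}) (S : {set 'I_n}) (i j k l m : 'I_n).
Implicit Type b : 'I_n -> 'I_n -> R.

(** A uniform [s] sends [i] to a uniform point of [S]: the left sum does not depend on [i] in [S],
    and summing it over all such [i] runs through every image once. *)
Lemma sum_sym_image1 S i (G : 'I_n -> R) : i \in S ->
  #|S|%:R * (\sum_(s : {perm 'I_n} | perm_on S s) G (s i)) = (#|S|`!)%:R * \sum_(l in S) G l.
Proof.
move=> iS.
have E l : l \in S -> \sum_(s : {perm 'I_n} | perm_on S s) G (s i) =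
                      \sum_(s : {perm 'I_n} | perm_on S s) G (s l).
  move=> lS; rewrite -(sum_sym_mull _ (tperm_on_set iS lS)).
  by apply: eq_bigr => s _; rewrite permM tpermL.
rewrite mulr_natl -sumr_const (eq_bigr _ E) exchange_big /= -sum_perm_on_cst.
apply: eq_bigr => s sS; rewrite [RHS](reindex_inj (@perm_inj _ s)) /=.
by apply: eq_bigl => l; rewrite perm_closed.
Qed.

Lemma sum_neq_cst S l (c : R) : l \in S -> \sum_(m in S | m != l) c = (#|S|.-1)%:R * c.
Proof.
move=> lS; rewrite (eq_bigl (mem (S :\ l))) => [|m]; last by rewrite inE in_setD1 andbC.
rewrite sumr_const mulr_natl; congr (_ *+ _).
by rewrite (cardsD1 l S) lS.
Qed.

Lemma sum_sym_image2 S i k (G : 'I_n -> 'I_n -> R) : i \in S -> k \in S -> i != k ->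
  (#|S| * #|S|.-1)%:R * (\sum_(s : {perm 'I_n} | perm_on S s) G (s i) (s k)) =
  (#|S|`!)%:R * \sum_(l in S) \sum_(m in S | m != l) G l m.
Proof.
move=> iS kS ik.
have E l m : l \in S -> m \in S -> m != l ->
    \sum_(s : {perm 'I_n} | perm_on S s) G (s i) (s k) =
    \sum_(s : {perm 'I_n} | perm_on S s) G (s l) (s m).
  move=> lS mS ml; pose k' := tperm i l k.
  have k'S : k' \in S by rewrite perm_closed //; apply: tperm_on_set.
  (* This product of two transpositions carries the ordered pair [(i, k)] to [(l, m)]. *)
  have tS : perm_on S (tperm i l * tperm k' m)%g.
    by apply: perm_onM; apply: tperm_on_set.
  rewrite -(sum_sym_mull _ tS); apply: eq_bigr => s _.
  rewrite -!mulgA !permM tpermL -/k' tpermL [in G _]tpermD //.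
  by rewrite -[X in _ != X](tpermL i) (inj_eq perm_inj) eq_sym.
rewrite -sum_perm_on_cst.
transitivity (\sum_(l in S) \sum_(m in S | m != l)
    \sum_(s : {perm 'I_n} | perm_on S s) G (s l) (s m)).
  transitivity (\sum_(l in S) \sum_(m in S | m != l)
      \sum_(s : {perm 'I_n} | perm_on S s) G (s i) (s k)); last first.
    by apply: eq_bigr => l lS; apply: eq_bigr => m /andP[mS ml]; apply: E.
  rewrite natrM -mulrA [LHS]mulr_natl -sumr_const; apply: eq_bigr => l lS.
  by rewrite sum_neq_cst.
under eq_bigr => l lS do rewrite exchange_big /=.
rewrite exchange_big /=; apply: eq_bigr => s sS.
rewrite [RHS](reindex_inj (@perm_inj _ s)) /=.
apply: eq_big => [l|l _]; first by rewrite perm_closed.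
rewrite [RHS](reindex_inj (@perm_inj _ s)) /=.
by apply: eq_bigl => m; rewrite perm_closed // (inj_eq perm_inj).
Qed.

Lemma perm_onT s : perm_on setT s.
Proof. by apply/subsetP => x _; rewrite inE. Qed.

Lemma sum_image1 i (G : 'I_n -> R) :
  n%:R * (\sum_(p : {perm 'I_n}) G (p i)) = (n`!)%:R * \sum_l G l.
Proof.
have := sum_sym_image1 G (in_setT i); rewrite cardsT card_ord.
rewrite (eq_bigl xpredT) => [->|s]; last exact: perm_onT.
by congr (_ * _); apply: eq_bigl => l; rewrite inE.
Qed.

Lemma sum_image2 i k (G : 'I_n -> 'I_n -> R) : i != k ->
  (n * n.-1)%:R * (\sum_(p : {perm 'I_n}) G (p i) (p k)) = (n`!)%:R * \sum_l \sum_(m | m != l) G l m.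
Proof.
move=> ik; have := sum_sym_image2 G (in_setT i) (in_setT k) ik; rewrite cardsT card_ord.
rewrite (eq_bigl xpredT) => [->|s]; last exact: perm_onT.
congr (_ * _); apply: eq_big => [l|l _]; first by rewrite inE.
by apply: eq_bigl => m; rewrite inE.
Qed.

Definition mean f : R := (n`!)%:R^-1 * \sum_p f p.
Definition cell f i j : R := (n.-1`!)%:R^-1 * \sum_(p : {perm 'I_n} | p i == j) f p.
(** The factor [(n-1)/n] is the inverse of the one in [symsumC1_diagsum]; with it
    [mean f + diagsum (coef f)] has the same cell averages as [f], which makes it the orthogonal
    projection of [f]. *)
Definition coef f i j : R := n.-1%:R / n%:R * (cell f i j - mean f).
Definition diagsum b p : R := \sum_i b i (p i).
Definition rest f p : R := f p - mean f - diagsum (coef f) p.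

Hypothesis n_gt1 : (1 < n)%N.

Let n_neq0 : n%:R != 0 :> R. Proof. by rewrite pnatr_eq0; lia. Qed.
Let n1_neq0 : n.-1%:R != 0 :> R. Proof. by rewrite pnatr_eq0; lia. Qed.
Let nE : n%:R = n.-1%:R + 1 :> R. Proof. by rewrite natr1; congr (_%:R); lia. Qed.
Let fact_neq0 (a : nat) : (a`!)%:R != 0 :> R. Proof. by rewrite pnatr_eq0 -lt0n fact_gt0. Qed.
Let factE : (n`!)%:R = n%:R * (n.-1`!)%:R :> R.
Proof. by rewrite -natrM; congr (_%:R); case: (n) n_gt1. Qed.

Let fact_mean f : (n.-1`!)%:R^-1 * (\sum_p f p) = n%:R * mean f.
Proof. by rewrite /mean factE invfM -[in RHS]mulrA mulVKf. Qed.

Lemma cell_row f i : \sum_j cell f i j = n%:R * mean f.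
Proof.
rewrite -mulr_sumr -fact_mean; congr (_ * _).
by rewrite [RHS](partition_big (fun p : {perm 'I_n} => p i) xpredT).
Qed.

Lemma cell_col f j : \sum_i cell f i j = n%:R * mean f.
Proof.
rewrite -mulr_sumr -fact_mean; congr (_ * _).
rewrite [RHS](partition_big (fun p : {perm 'I_n} => p^-1%g j) xpredT) //=.
by apply: eq_bigr => i _; apply: eq_bigl => p; apply/eqP/eqP => <-; rewrite ?permK ?permKV.
Qed.

Lemma coef_row f i : \sum_j coef f i j = 0.
Proof.
by rewrite -mulr_sumr sumrB cell_row sumr_const card_ord [n%:R * _]mulr_natl subrr mulr0.
Qed.

Lemma coef_col f j : \sum_i coef f i j = 0.
Proof.
by rewrite -mulr_sumr sumrB cell_col sumr_const card_ord [n%:R * _]mulr_natl subrr mulr0.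
Qed.

Lemma perm_onC1 i s : perm_on [set~ i] s = (s i == i).
Proof.
apply/idP/eqP => [/out_perm|si]; first by apply; rewrite !inE eqxx.
by apply/subsetP => x; rewrite !inE; apply: contraNneq => ->; rewrite si.
Qed.

Lemma cardsC1_ord i : #|[set~ i]| = n.-1.
Proof. by rewrite cardsC1 card_ord. Qed.

Lemma symsumC1_cell f i p : symsum [set~ i] f p = (n.-1`!)%:R * cell f i (p i).
Proof.
rewrite /cell. rewrite (mulVKf (fact_neq0 n.-1)) [RHS](reindex_inj (mulIg p)) /=.
by apply: eq_bigl => s; rewrite perm_onC1 permM (inj_eq perm_inj).
Qed.

(** Permutations fixing [i] leave the summand of row [i] alone. In a row [k] other than [i] the
    average runs over all values but [p i], so it is [- b k (p i) / (n-1)]; the zero column sum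
    turns the total of these into [b i (p i) / (n-1)]. *)
Lemma symsumC1_diagsum b i p :
  (forall k, \sum_j b k j = 0) -> (forall j, \sum_k b k j = 0) ->
  symsum [set~ i] (diagsum b) p = (n.-1`!)%:R * (n%:R / n.-1%:R) * b i (p i).
Proof.
move=> br bc; rewrite /symsum /diagsum exchange_big (bigD1 i) //=.
have -> : \sum_(s | perm_on [set~ i] s) b i ((s * p)%g i) = (n.-1`!)%:R * b i (p i).
  rewrite -(cardsC1_ord i) -sum_perm_on_cst; apply: eq_bigr => s.
  by rewrite perm_onC1 permM => /eqP ->.
rewrite (eq_bigr (fun k => - ((n.-1`!)%:R / n.-1%:R * b k (p i)))) => [|k ki].
  rewrite sumrN -mulr_sumr; move: (bc (p i)); rewrite (bigD1 i) //= => /eqP.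
  by rewrite addrC addr_eq0 => /eqP ->; rewrite nE; field.
have kS : k \in [set~ i] by rewrite !inE.
have := sum_sym_image1 (fun l => b k (p l)) kS; rewrite cardsC1_ord.
move=> /= H; under eq_bigr => s _ do rewrite permM.
apply: (mulfI n1_neq0); rewrite H.
have -> : \sum_(l in [set~ i]) b k (p l) = - b k (p i).
  have := br k; rewrite (reindex_inj (@perm_inj _ p)) (bigD1 i) //= => /eqP.
  rewrite addrC addr_eq0 => /eqP <-; apply: eq_bigl => l.
  by rewrite !inE.
by field.
Qed.

(** For [S] the complement of a point this compares cell averages; the whole symmetric group is a
    union of cosets of such a stabiliser. *)
Lemma symsum_rest f S p : (n.-1 <= #|S|)%N -> symsum S (rest f) p = 0.
Proof.
have C1 i q : symsum [set~ i] (rest f) q = 0.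
  rewrite /rest /symsum !sumrB sum_perm_on_cst cardsC1_ord -/(symsum _ _ _).
  rewrite symsumC1_cell -/(symsum _ (diagsum (coef f)) _) symsumC1_diagsum.
  - by rewrite /coef; field; rewrite n_neq0 n1_neq0.
  - exact: coef_row.
  - exact: coef_col.
move=> cS; case: (eqVneq S setT) => [->|ST].
  have i : 'I_n by apply: (@Ordinal _ 0); lia.
  have <- : i |: [set~ i] = setT by apply/setP => x; rewrite !inE orbN.
  rewrite symsumU1 ?inE ?eqxx //; apply: big1 => l _; exact: C1.
have /existsP[i iS] : [exists i, i \notin S].
  by apply: contraR ST => /existsPn H; apply/eqP/setP => x; rewrite inE; apply/negPn.
suff -> : S = [set~ i] by [].
apply/eqP; rewrite eqEcard cardsC1_ord cS andbT.
by apply/subsetP => x xS; rewrite !inE; apply: contraNneq iS => <-.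
Qed.

(** A transposition alters two summands only. On summing over all pairs, the two old values survive
    with weight [n] each and the two new values cancel by the zero row sums. *)
Lemma lap_diagsum b p :
  (forall k, \sum_j b k j = 0) -> lap (diagsum b) p = n%:R * diagsum b p.
Proof.
move=> br; rewrite /lap.
have E i k : diagsum b p - diagsum b (tperm i k * p)%g =
    b i (p i) + b k (p k) - b i (p k) - b k (p i).
  rewrite /diagsum -sumrB; case: (eqVneq i k) => [<-|ik].
    rewrite tperm1 mul1g sumrB; ring.
  rewrite (bigD1 i) //= (bigD1 k) ?(eq_sym k) //= big1 => [|l /andP[li lk]].
    by rewrite !permM tpermL tpermR; ring.
  by rewrite permM tpermD ?subrr // eq_sym.
have rowz k : \sum_l b k (p l) = 0 by have := br k; rewrite (reindex_inj (@perm_inj _ p)).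
have -> : \sum_i \sum_k (diagsum b p - diagsum b (tperm i k * p)%g) =
    n%:R * diagsum b p + n%:R * diagsum b p.
  under eq_bigr => i _ do under eq_bigr => k _ do rewrite E.
  under eq_bigr => i _ do rewrite !sumrB big_split /= rowz subr0 sumr_const card_ord.
  rewrite sumrB big_split /= sumr_const card_ord sumrMnl [X in _ - X]exchange_big /=.
  by rewrite [X in _ - X]big1 ?subr0 ?mulr_natl // => k _; apply: rowz.
by field.
Qed.

(* For [#|S| = n.-1] this says that [f] is orthogonal to the indicators of all the T_ij. *)
Definition flat f := forall S p, (n.-1 <= #|S|)%N -> symsum S f p = 0.

(** A function of [p i] is unchanged when [p] is multiplied on the left by a permutation fixing [i],
    so [f] may be replaced by its sum over that stabiliser, which is zero. *)
Lemma flat_orth f b (c : R) : flat f -> \sum_p f p * (c + diagsum b p) = 0.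
Proof.
move=> ff.
have f0 i (G : 'I_n -> R) : \sum_p f p * G (p i) = 0.
  apply: (mulfI (fact_neq0 n.-1)); rewrite mulr0 -(cardsC1_ord i) -sum_perm_on_cst.
  transitivity (\sum_(s | perm_on [set~ i] s) \sum_p f (s * p)%g * G (p i)).
    apply: eq_bigr => s; rewrite perm_onC1 => /eqP si.
    rewrite -(sum_mull s (fun p => f p * G (p i))); apply: eq_bigr => p _.
    by rewrite permM si.
  rewrite exchange_big big1 //= => p _; rewrite -mulr_suml.
  by rewrite [X in X * _](ff [set~ i] p) ?mul0r // cardsC1_ord.
have i : 'I_n by apply: (@Ordinal _ 0); lia.
under eq_bigr => p _ do rewrite mulrDr.
rewrite big_split /= (f0 i (fun=> c)) add0r /diagsum.
under eq_bigr => p _ do rewrite mulr_sumr.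
by rewrite exchange_big big1 //= => k _; rewrite f0.
Qed.

Lemma flat_lap f : flat f -> flat (lap f).
Proof.
move=> ff S p cS; rewrite symsum_lap /lap big1 ?mulr0 // => i _; apply: big1 => k _.
by rewrite !ff // subrr.
Qed.

Lemma lap_cst_diagsum f (c : R) b p :
  (forall k, \sum_j b k j = 0) -> lap (fun q => f q + (c + diagsum b q)) p =
  lap f p + n%:R * diagsum b p.
Proof.
move=> br; rewrite -lap_diagsum // /lap -mulrDr; congr (_ * _).
rewrite -big_split; apply: eq_bigr => i _; rewrite -big_split; apply: eq_bigr => k _ /=; ring.
Qed.

Lemma decompE f p : f p = rest f p + (mean f + diagsum (coef f) p).
Proof. by rewrite /rest; ring. Qed.

Lemma lap_decomp f p : lap f p = lap (rest f) p + n%:R * diagsum (coef f) p.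
Proof.
rewrite -(lap_cst_diagsum (rest f) (mean f)); last exact: coef_row.
by rewrite /lap; congr (_ * _); apply: eq_bigr => i _; apply: eq_bigr => k _; rewrite -!decompE.
Qed.

Lemma flat_rest f : flat (rest f). Proof. by move=> S p; apply: symsum_rest. Qed.

(** Put [z = lap (rest e) - nu * rest e]. It is flat, and the eigenvalue equation also puts it in
    the span of the T_ij, so it is orthogonal to itself and vanishes. Then [rest e] is an
    eigenvector to which [lap_eigen_ge] applies, hence zero, and [e] lies in the span orthogonal to
    [f]. *)
Lemma flat_eigen_orth f e nu : flat f -> (forall p, lap e p = nu * e p) ->
  nu < (n.-1 * 2)%:R -> \sum_p f p * e p = 0.
Proof.
move=> ff Le nulow.
pose z p := lap (rest e) p - nu * rest e p.
have zE p : z p = nu * mean e + diagsum (fun i j => (nu - n%:R) * coef e i j) p.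
  have -> : diagsum (fun i j => (nu - n%:R) * coef e i j) p = (nu - n%:R) * diagsum (coef e) p.
    by rewrite /diagsum mulr_sumr.
  by have := Le p; rewrite lap_decomp (decompE e p) /z => H; move: H; nra.
have fz : flat z.
  move=> S p cS.
  have -> : symsum S z p = symsum S (lap (rest e)) p - nu * symsum S (rest e) p.
    by rewrite /symsum [in RHS]mulr_sumr -sumrB.
  by rewrite (flat_lap (flat_rest e)) // flat_rest // mulr0 subrr.
have z0 p : z p = 0.
  have := flat_orth (fun i j => (nu - n%:R) * coef e i j) (nu * mean e) fz.
  under eq_bigr => q _ do rewrite -zE -expr2.
  move/eqP; rewrite psumr_eq0 => [/allP/(_ p)|q _]; last exact: sqr_ge0.
  by rewrite mem_index_enum sqrf_eq0 => /(_ isT) /eqP.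
have rest0 p : rest e p = 0.
  apply/eqP/negPn/negP => rp; move: nulow; rewrite ltNge => /negP; apply.
  apply: (@lap_eigen_ge _ _ (rest e)); last by exists p.
    by move=> q; apply/eqP; rewrite -subr_eq0; apply/eqP; apply: z0.
  by move=> S cS q; apply: flat_rest.
rewrite -[RHS](flat_orth (coef e) (mean e) ff); apply: eq_bigr => p _.
by rewrite {1}(decompE e p) rest0 add0r.
Qed.

Definition lapker p q : R := 2^-1 * \sum_i \sum_k ((q == p)%:R - (q == tperm i k * p)%g%:R).

Lemma lapkerE f p : lap f p = \sum_q lapker p q * f q.
Proof.
apply/esym; rewrite /lapker; under eq_bigr => q _ do rewrite -mulrA mulr_suml.
rewrite -mulr_sumr exchange_big /lap; congr (_ * _); apply: eq_bigr => i _ /=.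
under eq_bigr => q _ do rewrite mulr_suml.
rewrite exchange_big /=; apply: eq_bigr => k _.
have D q : \sum_r (r == q)%:R * f r = f q.
  by rewrite (bigD1 q) //= eqxx mul1r big1 ?addr0 // => r /negbTE ->; rewrite mul0r.
under eq_bigr => q _ do rewrite mulrBl.
by rewrite sumrB !D.
Qed.

Lemma lapker_sym p q : lapker p q = lapker q p.
Proof.
rewrite /lapker; congr (_ * _); apply: eq_bigr => i _; apply: eq_bigr => k _.
rewrite eq_sym; congr (_ - _%:R); congr nat_of_bool.
by apply/eqP/eqP => ->; rewrite mulgA tperm2 mul1g.
Qed.

(** Enumerating the group makes [lap] a symmetric matrix; [flat_eigen_orth] is then the
    orthogonality that [rayleigh_ge] asks for. *)
Lemma second_gap f : flat f -> (n.-1 * 2)%:R * (\sum_p f p ^+ 2) <= \sum_p f p * lap f p.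
Proof.
move=> ff; pose N := #|{perm 'I_n}|.
pose K : 'M[R]_N := \matrix_(x, y) lapker (enum_val x) (enum_val y).
pose v : 'rV[R]_N := \row_x f (enum_val x).
have Ksym : K^T = K by apply/matrixP => x y; rewrite !mxE lapker_sym.
have sumE (F : {perm 'I_n} -> R) : \sum_p F p = \sum_(x < N) F (enum_val x).
  rewrite [RHS](reindex (@enum_rank {perm 'I_n})) /=; last exact: onW_bij (@enum_rank_bij _).
  by apply: eq_bigr => p _; rewrite enum_rankK.
have vK (e : 'rV[R]_N) x : (e *m K) 0 x = lap (fun p => e 0 (enum_rank p)) (enum_val x).
  rewrite lapkerE sumE mxE; apply: eq_bigr => y _.
  by rewrite mxE enum_valK lapker_sym mulrC.
have := @rayleigh_ge R N K v (n.-1 * 2)%:R Ksym; rewrite !mxE.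
have -> : \sum_j v 0 j * v^T j 0 = \sum_p f p ^+ 2.
  by rewrite sumE; apply: eq_bigr => x _; rewrite !mxE expr2.
have -> : \sum_j (v *m K) 0 j * v^T j 0 = \sum_p f p * lap f p.
  rewrite sumE; apply: eq_bigr => x _; rewrite vK !mxE mulrC; congr (_ * _).
  by rewrite !lapkerE; apply: eq_bigr => p _; rewrite mxE enum_rankK.
apply=> e nu nulow /rowP eK; apply/matrixP => a b; rewrite !ord1 !mxE.
rewrite -[RHS](@flat_eigen_orth f (fun p => e 0 (enum_rank p)) nu ff) //.
  by rewrite sumE; apply: eq_bigr => x _; rewrite !mxE enum_valK.
by move=> p; have := eK (enum_rank p); rewrite vK enum_rankK mxE.
Qed.

End Projection.

(** * Boolean functions close to a sum of functions of single coordinates *)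

Section ProductVariance.
Variable R : rcfType.

(** The cap matters for large differences: a product of two squares has degree four, while the
    errors that are to control it have degree two. *)
Definition trunc_sqr (u : R) : R := Num.min (u ^+ 2) 1.

Lemma trunc_sqr_ge0 u : 0 <= trunc_sqr u.
Proof. by rewrite /trunc_sqr le_min sqr_ge0 ler01. Qed.

Lemma trunc_sqr_le1 u : trunc_sqr u <= 1.
Proof. by rewrite /trunc_sqr ge_min lexx orbT. Qed.

Lemma trunc_sqr_le u : trunc_sqr u <= u ^+ 2.
Proof. by rewrite /trunc_sqr ge_min lexx. Qed.

(* If all four errors were small, the Boolean values would satisfy [f11 - f21 = f12 - f22], and
   then one of the two increments vanishes. *)
Lemma trunc_sqr_mul_le (f11 f12 f21 f22 : bool) (x1 x2 y1 y2 : R) :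
  trunc_sqr (x1 - x2) * trunc_sqr (y1 - y2) <=
  16 * ((f11%:R - (x1 + y1)) ^+ 2 + (f12%:R - (x1 + y2)) ^+ 2 +
        (f21%:R - (x2 + y1)) ^+ 2 + (f22%:R - (x2 + y2)) ^+ 2).
Proof.
have gu0 := trunc_sqr_ge0 (x1 - x2); have gv0 := trunc_sqr_ge0 (y1 - y2).
have gu1 := trunc_sqr_le1 (x1 - x2); have gv1 := trunc_sqr_le1 (y1 - y2).
have guu := trunc_sqr_le (x1 - x2); have gvv := trunc_sqr_le (y1 - y2).
have prod_le1 : trunc_sqr (x1 - x2) * trunc_sqr (y1 - y2) <= 1.
  by rewrite -[1]mulr1; apply: ler_pM.
have prod_leu : trunc_sqr (x1 - x2) * trunc_sqr (y1 - y2) <= (x1 - x2) ^+ 2.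
  by rewrite -[X in _ <= X]mulr1; apply: ler_pM.
have prod_lev : trunc_sqr (x1 - x2) * trunc_sqr (y1 - y2) <= (y1 - y2) ^+ 2.
  by rewrite -[X in _ <= X]mul1r; apply: ler_pM.
move: (trunc_sqr _ * trunc_sqr _) prod_le1 prod_leu prod_lev => w w1 wu wv.
(* The alternating sum of the four errors is free of the [x] and [y], hence an integer. If it is
   nonzero the errors alone exceed a constant; if it is zero, then [f11 = f21] or [f11 = f12], and a
   difference of two errors is [x1 - x2] or [y1 - y2] up to sign. *)
have sq4 (a b c d : R) : (a - b - c + d) ^+ 2 <= 4 * (a ^+ 2 + b ^+ 2 + c ^+ 2 + d ^+ 2).
  by have := sqr_ge0 (a + b); have := sqr_ge0 (a + c); have := sqr_ge0 (a - d);
     have := sqr_ge0 (b - c); have := sqr_ge0 (b + d); have := sqr_ge0 (c + d); nra.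
have sq2 (a b : R) : (a - b) ^+ 2 <= 2 * (a ^+ 2 + b ^+ 2) by have := sqr_ge0 (a + b); nra.
set r11 := _ - (x1 + y1); set r12 := _ - (x1 + y2).
set r21 := _ - (x2 + y1); set r22 := _ - (x2 + y2).
have q11 := sqr_ge0 r11; have q12 := sqr_ge0 r12; have q21 := sqr_ge0 r21; have q22 := sqr_ge0 r22.
have alt := sq4 r11 r21 r12 r22.
have du1 := sq2 r11 r21; have du2 := sq2 r12 r22; have dv1 := sq2 r11 r12; have dv2 := sq2 r21 r22.
have altE : r11 - r21 - r12 + r22 = f11%:R - f21%:R - f12%:R + f22%:R by rewrite /r11 /r21 /r12 /r22; ring.
have du1E : r11 - r21 = f11%:R - f21%:R - (x1 - x2) by rewrite /r11 /r21; ring.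
have dv1E : r11 - r12 = f11%:R - f12%:R - (y1 - y2) by rewrite /r11 /r12; ring.
rewrite altE in alt; rewrite du1E in du1; rewrite dv1E in dv1.
move: r11 r12 r21 r22 q11 q12 q21 q22 alt du1 du2 dv1 dv2 {altE du1E dv1E} =>
  r11 r12 r21 r22 q11 q12 q21 q22 alt du1 _ dv1 _.
case: f11 alt du1 dv1; case: f12; case: f21; case: f22 => /= alt du1 dv1; lra.
Qed.

(** The Boolean values differ by at most 1, so any part of [x1 - x2] beyond that must come from the
    errors. *)
Lemma sqr_le_trunc_sqr (f1 f2 : bool) (x1 x2 y : R) :
  (x1 - x2) ^+ 2 <= 4 * trunc_sqr (x1 - x2) +
    8 * ((f1%:R - (x1 + y)) ^+ 2 + (f2%:R - (x2 + y)) ^+ 2).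
Proof.
have q1 := sqr_ge0 (f1%:R - (x1 + y)); have q2 := sqr_ge0 (f2%:R - (x2 + y)).
rewrite /trunc_sqr; case: (lerP ((x1 - x2) ^+ 2) 1) => H.
  by have := sqr_ge0 (x1 - x2); lra.
set r1 := _ - (x1 + y) in q1 *; set r2 := _ - (x2 + y) in q2 *.
have -> : x1 - x2 = (f1%:R - f2%:R) - (r1 - r2) by rewrite /r1 /r2; ring.
have d1 : (f1%:R - f2%:R : R) ^+ 2 <= 1 by case: (f1); case: (f2) => /=; lra.
have := sqr_ge0 (r1 + r2); have := sqr_ge0 ((f1%:R - f2%:R : R) + (r1 - r2)); nra.
Qed.

(** Summing the corner inequality over all quadruples bounds the product [A * B] of truncated
    variances; summing [sqr_le_trunc_sqr] bounds [a] by [A] and [b] by [B]. In the product of these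
    two bounds the mixed terms use the trivial bounds on [A] and [B], and 1152 arises as 16 * 64 +
    64 + 64. *)
Lemma product_variance_le (I J : finType) (P : pred I) (Q : pred J)
    (F : I -> J -> bool) (X : I -> R) (Y : J -> R) (e : R) :
  e = \sum_(i | P i) \sum_(j | Q j) ((F i j)%:R - (X i + Y j)) ^+ 2 ->
  (\sum_(i | P i) \sum_(i' | P i') (X i - X i') ^+ 2) *
  (\sum_(j | Q j) \sum_(j' | Q j') (Y j - Y j') ^+ 2) <=
  1152 * (#|P|%:R * #|Q|%:R) * e + 256 * e ^+ 2.
Proof.
set M : R := #|P|%:R; set N : R := #|Q|%:R.
pose r i j := ((F i j)%:R - (X i + Y j)) ^+ 2.
move=> eE0; have eE : e = \sum_(i | P i) \sum_(j | Q j) r i j := eE0.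
set a := (X in X * _ <= _); set b := (X in _ * X <= _).
pose A := \sum_(i | P i) \sum_(i' | P i') trunc_sqr (X i - X i').
pose B := \sum_(j | Q j) \sum_(j' | Q j') trunc_sqr (Y j - Y j').
have eC : e = \sum_(j | Q j) \sum_(i | P i) r i j by rewrite eE [RHS]exchange_big.
have r0 i j : 0 <= r i j by apply: sqr_ge0.
have e0 : 0 <= e by rewrite eE; apply: sumr_ge0 => i _; apply: sumr_ge0 => j _; apply: r0.
have M0 : 0 <= M by rewrite /M ler0n.
have N0 : 0 <= N by rewrite /N ler0n.
have A0 : 0 <= A by apply: sumr_ge0 => i _; apply: sumr_ge0 => i' _; apply: trunc_sqr_ge0.
have B0 : 0 <= B by apply: sumr_ge0 => i _; apply: sumr_ge0 => i' _; apply: trunc_sqr_ge0.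
have a0 : 0 <= a by apply: sumr_ge0 => i _; apply: sumr_ge0 => i' _; apply: sqr_ge0.
have b0 : 0 <= b by apply: sumr_ge0 => i _; apply: sumr_ge0 => i' _; apply: sqr_ge0.
have cM (c : R) : \sum_(i | P i) c = M * c by rewrite sumr_const mulr_natl.
have cN (c : R) : \sum_(j | Q j) c = N * c by rewrite sumr_const mulr_natl.
have AM : A <= M * (M * 1).
  by rewrite -!cM; apply: ler_sum => i _; apply: ler_sum => i' _; apply: trunc_sqr_le1.
have BN : B <= N * (N * 1).
  by rewrite -!cN; apply: ler_sum => i _; apply: ler_sum => i' _; apply: trunc_sqr_le1.
have ABe : A * B <= 64 * (M * N) * e.
  have -> : A * B = \sum_(i | P i) \sum_(i' | P i') \sum_(j | Q j) \sum_(j' | Q j')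
      trunc_sqr (X i - X i') * trunc_sqr (Y j - Y j').
    rewrite mulr_suml; apply: eq_bigr => i _; rewrite mulr_suml; apply: eq_bigr => i' _.
    by rewrite mulr_sumr; apply: eq_bigr => j _; rewrite mulr_sumr.
  have -> : 64 * (M * N) * e = \sum_(i | P i) \sum_(i' | P i') \sum_(j | Q j) \sum_(j' | Q j')
      16 * (r i j + r i j' + r i' j + r i' j').
    under eq_bigr => i _ do under eq_bigr => i' _ do under eq_bigr => j _ do
      rewrite -mulr_sumr !big_split /= !cN.
    under eq_bigr => i _ do under eq_bigr => i' _ do
      rewrite -mulr_sumr !big_split /= !cN -!mulr_sumr.
    under eq_bigr => i _ do rewrite -mulr_sumr !big_split /= !cM -!mulr_sumr.
    rewrite -mulr_sumr !big_split /= !cM -!mulr_sumr -eE; ring.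
  do 4![apply: ler_sum => ? _]; exact: trunc_sqr_mul_le.
have aA : N * a <= 4 * N * A + 16 * M * e.
  have -> : N * a = \sum_(i | P i) \sum_(i' | P i') \sum_(j | Q j) (X i - X i') ^+ 2.
    by rewrite mulr_sumr; apply: eq_bigr => i _; rewrite mulr_sumr; apply: eq_bigr => i' _; rewrite cN.
  have -> : 4 * N * A + 16 * M * e = \sum_(i | P i) \sum_(i' | P i') \sum_(j | Q j)
      (4 * trunc_sqr (X i - X i') + 8 * (r i j + r i' j)).
    under eq_bigr => i _ do under eq_bigr => i' _ do
      rewrite big_split /= cN -mulr_sumr big_split /=.
    under eq_bigr => i _ do
      rewrite big_split /= -!mulr_sumr big_split /= cM.
    rewrite big_split /= -!mulr_sumr big_split /= cM -!mulr_sumr -/A -eE; ring.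
  do 3![apply: ler_sum => ? _]; exact: sqr_le_trunc_sqr.
have bB : M * b <= 4 * M * B + 16 * N * e.
  have -> : M * b = \sum_(j | Q j) \sum_(j' | Q j') \sum_(i | P i) (Y j - Y j') ^+ 2.
    by rewrite mulr_sumr; apply: eq_bigr => i _; rewrite mulr_sumr; apply: eq_bigr => i' _; rewrite cM.
  have -> : 4 * M * B + 16 * N * e = \sum_(j | Q j) \sum_(j' | Q j') \sum_(i | P i)
      (4 * trunc_sqr (Y j - Y j') + 8 * (r i j + r i j')).
    under eq_bigr => i _ do under eq_bigr => i' _ do
      rewrite big_split /= cM -mulr_sumr big_split /=.
    under eq_bigr => i _ do
      rewrite big_split /= -!mulr_sumr big_split /= cN.
    rewrite big_split /= -!mulr_sumr big_split /= cN -!mulr_sumr -/B -eC; ring.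
  do 3![apply: ler_sum => ? _]; rewrite /r ![X _ + _]addrC; exact: sqr_le_trunc_sqr.
have [MN0|MN0] := eqVneq (M * N) 0.
  have : a * b = 0.
    move/eqP: MN0; rewrite mulf_eq0 !pnatr_eq0 => /orP[] /eqP/card0_eq Z.
      by rewrite /a big1 ?mul0r // => i Pi; have : P i = false := Z i; rewrite Pi.
    by rewrite /b [X in a * X]big1 ?mulr0 // => j Qj; have : Q j = false := Z j; rewrite Qj.
  by move=> ->; rewrite MN0 mulr0 mul0r add0r mulr_ge0 ?sqr_ge0.
have MNp : 0 < M * N by rewrite lt0r MN0 mulr_ge0.
have ab : (N * a) * (M * b) <= (4 * N * A + 16 * M * e) * (4 * M * B + 16 * N * e).
  by apply: ler_pM => //; apply: mulr_ge0.
rewrite -(ler_pM2l MNp).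
have NA : N * N * A * e <= N * N * (M * (M * 1)) * e.
  by rewrite ler_wpM2r // ler_wpM2l // mulr_ge0.
have MB : M * M * B * e <= M * M * (N * (N * 1)) * e.
  by rewrite ler_wpM2r // ler_wpM2l // mulr_ge0.
have MNAB : M * N * (A * B) <= M * N * (64 * (M * N) * e) by rewrite ler_wpM2l // ltW.
apply: (@le_trans _ _ ((4 * N * A + 16 * M * e) * (4 * M * B + 16 * N * e))).
  by apply: le_trans ab; rewrite le_eqVlt; apply/orP; left; apply/eqP; ring.
have -> : (4 * N * A + 16 * M * e) * (4 * M * B + 16 * N * e) =
  16 * (M * N * (A * B)) + 64 * (N * N * A * e) + 64 * (M * M * B * e) + 256 * (M * N * e ^+ 2) by ring.
by lra.
Qed.

End ProductVariance.

(** * Variances of the two independent halves on a coset of Sym(S) x Sym(complement of S) *)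

Section BlockVariance.
Variables (R : rcfType) (n : nat).
Implicit Types (p q s t : {perm 'I_n}) (S : {set 'I_n}) (i j k l m : 'I_n).
Implicit Types (b B : 'I_n -> 'I_n -> R).

Definition bsq S B : R := \sum_(i in S) \sum_(k in S) B i k ^+ 2.
Definition brow S B : R := \sum_(i in S) (\sum_(k in S) B i k) ^+ 2.
Definition bcol S B : R := \sum_(k in S) (\sum_(i in S) B i k) ^+ 2.
Definition bsum S B : R := \sum_(i in S) \sum_(k in S) B i k.
(* [#|S|.-1] times the variance of [bdiag S B s] for a uniformly random [s] in [Sym S]. *)
Definition bvar S B : R := bsq S B - (brow S B + bcol S B) / #|S|%:R + (bsum S B / #|S|%:R) ^+ 2.
Definition bdiag S B s : R := \sum_(i in S) B i (s i).

Lemma bsq_ge0 S B : 0 <= bsq S B.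
Proof. by apply: sumr_ge0 => i _; apply: sumr_ge0 => k _; apply: sqr_ge0. Qed.

Lemma brow_ge0 S B : 0 <= brow S B. Proof. by apply: sumr_ge0 => i _; apply: sqr_ge0. Qed.
Lemma bcol_ge0 S B : 0 <= bcol S B. Proof. by apply: sumr_ge0 => i _; apply: sqr_ge0. Qed.

Lemma sum_neq S (F : 'I_n -> R) l : l \in S ->
  \sum_(m in S | m != l) F m = \sum_(m in S) F m - F l.
Proof. by move=> lS; rewrite [X in _ = X - _](bigD1 l) //= addrC addrK. Qed.

Lemma sum_bdiag S B :
  #|S|%:R * (\sum_(s : {perm 'I_n} | perm_on S s) bdiag S B s) = (#|S|`!)%:R * bsum S B.
Proof.
rewrite /bdiag exchange_big /bsum !mulr_sumr; apply: eq_bigr => i iS.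
by rewrite (sum_sym_image1 (B i) iS).
Qed.

(** Inclusion-exclusion over coinciding rows and coinciding columns. *)
Lemma sum_offdiag S B :
  \sum_(i in S) \sum_(k in S | k != i) \sum_(l in S) \sum_(m in S | m != l) B i l * B k m =
  bsum S B ^+ 2 - brow S B - bcol S B + bsq S B.
Proof.
pose r i := \sum_(k in S) B i k.
have E i k : \sum_(l in S) \sum_(m in S | m != l) B i l * B k m =
             r i * r k - \sum_(l in S) B i l * B k l.
  rewrite /r mulr_suml -sumrB; apply: eq_bigr => l lS.
  by rewrite sum_neq // mulr_sumr.
under eq_bigr => i iS do (under eq_bigr => k _ do rewrite E).
have -> : bsum S B ^+ 2 = \sum_(i in S) \sum_(k in S) r i * r k.
  by rewrite expr2 /bsum mulr_suml; apply: eq_bigr => i _; rewrite mulr_sumr.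
have -> : bcol S B = \sum_(i in S) \sum_(k in S) \sum_(l in S) B i l * B k l.
  rewrite /bcol; under [RHS]eq_bigr => i _ do rewrite exchange_big.
  rewrite [RHS]exchange_big; apply: eq_bigr => l _.
  by rewrite expr2 mulr_suml; apply: eq_bigr => i _; rewrite mulr_sumr.
rewrite /brow /bsq -!sumrB -big_split; apply: eq_bigr => i iS /=.
rewrite sum_neq // sumrB -expr2 -/(r i).
by under [X in _ - (_ - X)]eq_bigr => l _ do rewrite -expr2; ring.
Qed.

Lemma sum_bdiag_sqr S B : (1 < #|S|)%N ->
  #|S|%:R * #|S|.-1%:R * (\sum_(s : {perm 'I_n} | perm_on S s) bdiag S B s ^+ 2) =
  (#|S|`!)%:R * (#|S|%:R * bsq S B + bsum S B ^+ 2 - brow S B - bcol S B).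
Proof.
move=> S1; rewrite -natrM.
have aE : #|S|%:R = #|S|.-1%:R + 1 :> R by rewrite natr1 prednK // ltnW.
have -> : \sum_(s : {perm 'I_n} | perm_on S s) bdiag S B s ^+ 2 =
    \sum_(i in S) (\sum_(s : {perm 'I_n} | perm_on S s) B i (s i) ^+ 2 +
    \sum_(k in S | k != i) \sum_(s : {perm 'I_n} | perm_on S s) B i (s i) * B k (s k)).
  transitivity (\sum_(s : {perm 'I_n} | perm_on S s) \sum_(i in S) (B i (s i) ^+ 2 +
      \sum_(k in S | k != i) B i (s i) * B k (s k))).
    apply: eq_bigr => s _; rewrite expr2 {1}/bdiag mulr_suml; apply: eq_bigr => i iS.
    by rewrite -mulr_sumr sum_neq // mulrBr expr2 addrC subrK.
  rewrite exchange_big; apply: eq_bigr => i _; rewrite big_split; congr (_ + _).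
  by rewrite exchange_big.
rewrite mulr_sumr.
rewrite (eq_bigr (fun i => #|S|.-1%:R * ((#|S|`!)%:R * \sum_(l in S) B i l ^+ 2) +
   (#|S|`!)%:R * \sum_(k in S | k != i) \sum_(l in S) \sum_(m in S | m != l) B i l * B k m)); last first.
  move=> i iS; rewrite mulrDr; congr (_ + _).
    by rewrite -(sum_sym_image1 (fun l => B i l ^+ 2) iS) mulnC natrM mulrA.
  rewrite !mulr_sumr; apply: eq_bigr => k /andP[kS ki].
  by rewrite (sum_sym_image2 (fun l m => B i l * B k m) iS kS) // eq_sym.
rewrite big_split /= -!mulr_sumr sum_offdiag -/(bsq S B) aE; ring.
Qed.

Lemma sum_bdiag_diff_sqr S B : (1 < #|S|)%N ->
  #|S|.-1%:R * (\sum_(s : {perm 'I_n} | perm_on S s) \sum_(s' : {perm 'I_n} | perm_on S s')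
     (bdiag S B s - bdiag S B s') ^+ 2) = 2 * (#|S|`!)%:R ^+ 2 * bvar S B.
Proof.
move=> S1; have a0 : #|S|%:R != 0 :> R by rewrite pnatr_eq0; lia.
have a10 : #|S|.-1%:R != 0 :> R by rewrite pnatr_eq0; lia.
set F : R := (#|S|`!)%:R.
set X2 := \sum_(s : {perm 'I_n} | perm_on S s) bdiag S B s ^+ 2.
set X1 := \sum_(s : {perm 'I_n} | perm_on S s) bdiag S B s.
have -> : \sum_(s : {perm 'I_n} | perm_on S s) \sum_(s' : {perm 'I_n} | perm_on S s')
     (bdiag S B s - bdiag S B s') ^+ 2 = 2 * F * X2 - 2 * X1 ^+ 2.
  transitivity (\sum_(s : {perm 'I_n} | perm_on S s)
     (F * bdiag S B s ^+ 2 - 2 * (bdiag S B s * X1) + X2)).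
    apply: eq_bigr => s _; under eq_bigr => s' _ do rewrite sqrrB -[_ *+ 2]mulr_natl.
    by rewrite big_split sumrB /= sum_perm_on_cst -!mulr_sumr.
  by rewrite big_split sumrB /= sum_perm_on_cst -!mulr_sumr -mulr_suml -/X1 -/X2 -/F; ring.
have E2 := sum_bdiag_sqr B S1; have E1 := sum_bdiag S B.
rewrite -/X2 -/X1 -/F in E1 E2.
have aE : #|S|%:R = #|S|.-1%:R + 1 :> R by rewrite natr1 prednK // ltnW.
have X1E : X1 = F * bsum S B / #|S|%:R by rewrite -E1; field.
have X2E : X2 = F * (#|S|%:R * bsq S B + bsum S B ^+ 2 - brow S B - bcol S B) /
   (#|S|%:R * #|S|.-1%:R) by rewrite -E2; field; rewrite a0 a10.
rewrite X1E X2E /bvar; move: a0; rewrite aE => a0; field.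
by rewrite a0 a10.
Qed.

Lemma bvar_ge0 S B : (1 < #|S|)%N -> 0 <= bvar S B.
Proof.
move=> S1; have F0 : 0 < 2 * (#|S|`!)%:R ^+ 2 :> R.
  by rewrite mulr_gt0 // exprn_gt0 // ltr0n fact_gt0.
rewrite -(pmulr_rge0 _ F0) -sum_bdiag_diff_sqr // mulr_ge0 //.
by apply: sumr_ge0 => s _; apply: sumr_ge0 => s' _; apply: sqr_ge0.
Qed.

Lemma sqr_sum_le S (x : 'I_n -> R) : (\sum_(i in S) x i) ^+ 2 <= #|S|%:R * \sum_(i in S) x i ^+ 2.
Proof.
have : 0 <= \sum_(i in S) \sum_(k in S) (x i - x k) ^+ 2.
  by apply: sumr_ge0 => i _; apply: sumr_ge0 => k _; apply: sqr_ge0.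
have -> : \sum_(i in S) \sum_(k in S) (x i - x k) ^+ 2 =
    2 * (#|S|%:R * \sum_(i in S) x i ^+ 2) - 2 * (\sum_(i in S) x i) ^+ 2.
  transitivity (\sum_(i in S) (#|S|%:R * x i ^+ 2 - 2 * (x i * \sum_(k in S) x k) + \sum_(k in S) x k ^+ 2)).
    apply: eq_bigr => i _; under eq_bigr => k _ do rewrite sqrrB -[_ *+ 2]mulr_natl.
    by rewrite big_split sumrB /= sumr_const -!mulr_sumr mulr_natl.
  rewrite big_split sumrB /= sumr_const -!mulr_sumr -mulr_suml -[_ *+ #|S|]mulr_natl; ring.
lra.
Qed.

(** By Cauchy-Schwarz the row correction alone already outweighs the squared mean. *)
Lemma bvar_le S B : bvar S B <= bsq S B.
Proof.
case: (posnP #|S|) => [S0|Sp].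
  by rewrite /bvar S0 invr0 !mulr0 expr2 mulr0 subr0 addr0.
have a0 : 0 < #|S|%:R :> R by rewrite ltr0n.
have := sqr_sum_le S (fun i => \sum_(k in S) B i k).
rewrite -/(bsum S B) -/(brow S B) => H.
have H2 : (bsum S B / #|S|%:R) ^+ 2 <= brow S B / #|S|%:R.
  rewrite expr_div_n ler_pdivrMr ?exprn_gt0 //; apply: le_trans H _.
  by rewrite le_eqVlt; apply/orP; left; apply/eqP; field; rewrite gt_eqF.
have H3 : 0 <= bcol S B / #|S|%:R by rewrite divr_ge0 ?bcol_ge0 // ltW.
by rewrite /bvar mulrDl; lra.
Qed.

(** This covers the degenerate blocks, on which there is no variance to speak of; for empty [S] both
    sides are 0, the inverse of 0 being 0. *)
Lemma bsq_small S B : (#|S| <= 1)%N -> bsq S B <= (brow S B + bcol S B) / #|S|%:R.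
Proof.
move=> S1; case: (posnP #|S|) => [S0|Sp].
  by rewrite S0 invr0 mulr0 /bsq (cards0_eq S0) big_set0.
have /cards1P[x ->] : #|S| == 1%N by rewrite eqn_leq S1 Sp.
rewrite cards1 invr1 mulr1 /bsq /brow /bcol !big_set1.
by have := sqr_ge0 (B x x); lra.
Qed.

(** An upper bound for the loss in passing from [bsq] to [bvar]; it becomes small after averaging
    over blocks and starting permutations. *)
Definition corr S B : R := (brow S B + bcol S B) / #|S|%:R.

Lemma corr_ge0 S B : 0 <= corr S B.
Proof. by rewrite /corr divr_ge0 ?addr_ge0 ?brow_ge0 ?bcol_ge0. Qed.

Lemma bsq_corr_le S B : bsq S B - corr S B <= bvar S B.
Proof. by rewrite /bvar -/(corr S B); have := sqr_ge0 (bsum S B / #|S|%:R); lra. Qed.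

Definition total b : R := \sum_i \sum_j b i j ^+ 2.

Lemma bsq_le_total S b p : bsq S (fun i k => b i (p k)) <= total b.
Proof.
rewrite /bsq /total [X in _ <= X](bigID (mem S)) /= -[X in X <= _]addr0; apply: lerD.
  apply: ler_sum => i _; rewrite [X in _ <= X](reindex_inj (@perm_inj _ p)) /=.
  rewrite [X in _ <= X](bigID (mem S)) /= -[X in X <= _]addr0; apply: lerD => //.
  by apply: sumr_ge0 => k _; apply: sqr_ge0.
by apply: sumr_ge0 => i _; apply: sumr_ge0 => k _; apply: sqr_ge0.
Qed.

Lemma diagsum_split S b s t p : perm_on S s -> perm_on (~: S) t ->
  diagsum b (s * t * p)%g = bdiag S (fun i k => b i (p k)) s + bdiag (~: S) (fun i k => b i (p k)) t.
Proof.
move=> sS tS; rewrite /diagsum (bigID (mem S)) /=; congr (_ + _).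
  apply: eq_bigr => i iS; rewrite !permM (out_perm tS) //.
  by rewrite inE perm_closed // negbK.
apply: eq_big => [i|i iS]; first by rewrite inE.
by rewrite !permM (out_perm sS).
Qed.

(** The products [s * t * p] run over the right coset through [p] of the Young subgroup attached to
    [S] and its complement. *)
Definition coset_error (A : {set {perm 'I_n}}) (c : R) b S p : R :=
  \sum_(s | perm_on S s) \sum_(t | perm_on (~: S) t)
    (((s * t * p)%g \in A)%:R - (c + diagsum b (s * t * p)%g)) ^+ 2.

(** On the coset, [diagsum b] is a function of [s] plus a function of [t], so [product_variance_le]
    bounds the product of the two [bvar]; replacing [bvar] by [bsq] costs the [corr] terms. If a
    block has at most one point, [bsq_small] makes the left side nonpositive. *)
Lemma block_product_le (A : {set {perm 'I_n}}) (c : R) b B S p :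
  total b <= n%:R -> B = (fun i k => b i (p k)) ->
  (#|S|`! * #|~: S|`!)%:R * (bsq S B * bsq (~: S) B - total b * (corr S B + corr (~: S) B)) <=
  352 * n%:R ^+ 2 * coset_error A c b S p.
Proof.
move=> bn BE; set M := (_)%:R; set e := coset_error _ _ _ _ _.
have e0 : 0 <= e by apply: sumr_ge0 => s _; apply: sumr_ge0 => t _; apply: sqr_ge0.
have M0 : 0 < M by rewrite ltr0n muln_gt0 !fact_gt0.
have q0 := bsq_ge0 S B; have q'0 := bsq_ge0 (~: S) B.
have c0 := corr_ge0 S B; have c'0 := corr_ge0 (~: S) B.
have qW : bsq S B <= total b by rewrite BE bsq_le_total.
have q'W : bsq (~: S) B <= total b by rewrite BE bsq_le_total.
have W0 : 0 <= total b by apply: le_trans qW.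
have RHS0 : 0 <= 352 * n%:R ^+ 2 * e by rewrite !mulr_ge0 // sqr_ge0.
have small (q q' d d' : R) : 0 <= q -> 0 <= q' -> q' <= total b -> 0 <= d' -> q <= d ->
    M * (q * q' - total b * (d + d')) <= 352 * n%:R ^+ 2 * e.
  move=> ? ? ? ? qd; apply: le_trans RHS0; rewrite pmulr_rle0 // subr_le0.
  apply: (@le_trans _ _ (d * total b)); first by apply: ler_pM.
  by rewrite [d * _]mulrC ler_wpM2l //; lra.
case: (ltnP 1 #|S|) => [S1|S1]; last by apply: small => //; apply: bsq_small.
case: (ltnP 1 #|~: S|) => [S'1|S'1]; last first.
  rewrite [bsq S B * _]mulrC [corr S B + _]addrC; apply: small => //; exact: bsq_small.
have v0 := bvar_ge0 B S1; have v'0 := bvar_ge0 B S'1.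
have vq := bvar_le S B; have vq' := bvar_le (~: S) B.
have vc := bsq_corr_le S B; have vc' := bsq_corr_le (~: S) B.
(* If one [bsq] is below its [corr], the left side is nonpositive. Otherwise both differences
   [bsq - corr] are positive and can be multiplied. *)
have prod : bsq S B * bsq (~: S) B - total b * (corr S B + corr (~: S) B) <=
    bvar S B * bvar (~: S) B.
  move: (bsq S B) (bsq (~: S) B) (corr S B) (corr (~: S) B) (bvar S B) (bvar (~: S) B)
    q0 q'0 c0 c'0 qW q'W v0 v'0 vq vq' vc vc' => x x' d d' v v' x0 x'0 d0 d'0 xW x'W v0 v'0 _ _ vc vc'.
  have h1 : x * d' <= total b * d' by rewrite ler_wpM2r.
  have h2 : x' * d <= total b * d by rewrite ler_wpM2r.
  have vv0 : 0 <= v * v' by rewrite mulr_ge0.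
  case: (lerP x d) => xd.
    have : x * x' <= d * x' by rewrite ler_wpM2r.
    have : 0 <= total b * d' by rewrite mulr_ge0.
    by lra.
  case: (lerP x' d') => x'd.
    have : x * x' <= x * d' by rewrite ler_wpM2l.
    have : 0 <= total b * d by rewrite mulr_ge0.
    by lra.
  have : (x - d) * (x' - d') <= v * v' by apply: ler_pM => //; lra.
  have : 0 <= d * d' by rewrite mulr_ge0.
  by nra.
pose al := \sum_(s | perm_on S s) \sum_(s' | perm_on S s') (bdiag S B s - bdiag S B s') ^+ 2.
pose be := \sum_(t | perm_on (~: S) t) \sum_(t' | perm_on (~: S) t')
  (bdiag (~: S) B t - bdiag (~: S) B t') ^+ 2.
have alE : #|S|.-1%:R * al = 2 * (#|S|`!)%:R ^+ 2 * bvar S B by rewrite -sum_bdiag_diff_sqr.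
have beE : #|~: S|.-1%:R * be = 2 * (#|~: S|`!)%:R ^+ 2 * bvar (~: S) B by rewrite -sum_bdiag_diff_sqr.
have ab : al * be <= 1152 * M * e + 256 * e ^+ 2.
  have -> : al = \sum_(s | perm_on S s) \sum_(s' | perm_on S s')
      ((c + bdiag S B s) - (c + bdiag S B s')) ^+ 2.
    by apply: eq_bigr => s _; apply: eq_bigr => s' _; rewrite opprD addrACA subrr add0r.
  rewrite /M natrM -!card_perm.
  apply: (product_variance_le (F := fun s t => (s * t * p)%g \in A)).
  apply: eq_bigr => s sS; apply: eq_bigr => t tS.
  by rewrite (diagsum_split b p sS tS) addrA BE.
have nn : (#|S|.-1 * #|~: S|.-1)%:R <= n%:R ^+ 2 :> R.
  rewrite -natrX ler_nat -mulnn; apply: leq_mul.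
    by rewrite (leq_trans (leq_pred _)) // -[n in (_ <= n)%N]card_ord max_card.
  by rewrite (leq_trans (leq_pred _)) // -[n in (_ <= n)%N]card_ord max_card.
have main : 4 * M ^+ 2 * (bvar S B * bvar (~: S) B) <= n%:R ^+ 2 * (1152 * M * e + 256 * e ^+ 2).
  have -> : 4 * M ^+ 2 * (bvar S B * bvar (~: S) B) = (#|S|.-1 * #|~: S|.-1)%:R * (al * be).
    have -> : (#|S|.-1 * #|~: S|.-1)%:R * (al * be) = (#|S|.-1%:R * al) * (#|~: S|.-1%:R * be).
      by rewrite natrM; ring.
    by rewrite alE beE /M natrM; ring.
  apply: ler_pM => //; rewrite mulr_ge0 //; apply: sumr_ge0 => s _; apply: sumr_ge0 => t _; exact: sqr_ge0.
have vvn : bvar S B * bvar (~: S) B <= n%:R ^+ 2.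
  by rewrite expr2; apply: ler_pM => //; [apply: le_trans bn; apply: le_trans qW | apply: le_trans bn; apply: le_trans q'W].
apply: (@le_trans _ _ (M * (bvar S B * bvar (~: S) B))); first by rewrite ler_pM2l.
have N0 : 0 <= n%:R ^+ 2 :> R by apply: sqr_ge0.
(* For [e <= M] the quadratic term is absorbed, and (1152 + 256) / 4 = 352. For [e > M] the trivial
   bound [n ^ 2] on the product of variances suffices. *)
case: (lerP e M) => eM.
  rewrite -(ler_pM2l M0).
  have : n%:R ^+ 2 * (e * e) <= n%:R ^+ 2 * (M * e) by rewrite ler_wpM2l // ler_wpM2r.
  by rewrite expr2 in main *; lra.
have : M * (bvar S B * bvar (~: S) B) <= e * n%:R ^+ 2.
  by apply: ler_pM => //; rewrite ?mulr_ge0 // ltW.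
have : 0 <= n%:R ^+ 2 * e by rewrite mulr_ge0.
by lra.
Qed.

End BlockVariance.

(** * Averaging over random blocks and random starting permutations *)

Section Averaging.
Variables (R : rcfType) (n : nat).
Implicit Types (p q s t : {perm 'I_n}) (S : {set 'I_n}) (i j k l m : 'I_n).
Implicit Types (b B : 'I_n -> 'I_n -> R).

Lemma sum_coset_error (A : {set {perm 'I_n}}) (c : R) b S :
  \sum_p coset_error A c b S p =
  (#|S|`! * #|~: S|`!)%:R * \sum_p ((p \in A)%:R - (c + diagsum b p)) ^+ 2.
Proof.
pose F p : R := ((p \in A)%:R - (c + diagsum b p)) ^+ 2.
rewrite /coset_error exchange_big natrM -mulrA -sum_perm_on_cst; apply: eq_bigr => s _.
rewrite exchange_big -sum_perm_on_cst; apply: eq_bigr => t _.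
by rewrite (sum_mull (s * t)%g F).
Qed.

Definition toggle i S : {set 'I_n} := [set x | (x \in S) (+) (x == i)].

Lemma toggleK i : involutive (toggle i).
Proof. by move=> S; apply/setP => x; rewrite !inE -addbA addbb addbF. Qed.

Lemma in_toggle i S x : (x \in toggle i S) = (x \in S) (+) (x == i).
Proof. by rewrite inE. Qed.

Lemma sum_toggle (V : nmodType) i (F : {set 'I_n} -> V) : \sum_S F (toggle i S) = \sum_S F S.
Proof. by rewrite [RHS](reindex_inj (inv_inj (toggleK i))). Qed.

(* Pairing [S] with [toggle i S] makes membership of [i] a fair coin independent of [F]. *)
Lemma sum_half i (F : {set 'I_n} -> R) (x : bool) : (forall S, F (toggle i S) = F S) ->
  \sum_(S : {set 'I_n}) ((i \in S) == x)%:R * F S = 2^-1 * \sum_(S : {set 'I_n}) F S.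
Proof.
move=> Fi.
have E : \sum_(S : {set 'I_n}) ((i \in S) == x)%:R * F S =
         \sum_(S : {set 'I_n}) ((i \in S) != x)%:R * F S.
  rewrite -(sum_toggle i); apply: eq_bigr => S _; rewrite Fi in_toggle eqxx addbT.
  by case: (i \in S); case: x.
have : \sum_(S : {set 'I_n}) F S = \sum_(S : {set 'I_n}) ((i \in S) == x)%:R * F S +
         \sum_(S : {set 'I_n}) ((i \in S) != x)%:R * F S.
  by rewrite -big_split; apply: eq_bigr => S _ /=; case: eqP; rewrite ?mul1r ?mul0r ?addr0 ?add0r.
by rewrite -E => ->; field.
Qed.

Let NS : R := #|{set 'I_n}|%:R.

Lemma sum_ind S (F : 'I_n -> R) : \sum_(i in S) F i = \sum_i (i \in S)%:R * F i.
Proof. by rewrite big_mkcond; apply: eq_bigr => i _; case: (i \in S); rewrite ?mul1r ?mul0r. Qed.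

Lemma sum_ind1 i x : \sum_(S : {set 'I_n}) ((i \in S) == x)%:R = 2^-1 * NS.
Proof.
rewrite -[NS]mulr1 mulr_natl -sumr_const -(@sum_half i (fun=> 1) x) //.
by apply: eq_bigr => S _; rewrite mulr1.
Qed.

Lemma sum_ind2 i k x y : k != i ->
  \sum_(S : {set 'I_n}) ((k \in S) == y)%:R * ((i \in S) == x)%:R = 4^-1 * NS.
Proof.
move=> ki; rewrite sum_half => [|S]; last by rewrite in_toggle (eq_sym i) (negbTE ki) addbF.
by rewrite sum_ind1; field.
Qed.

Lemma sum_ind4 i k i' k' x y x' y' : uniq [:: i; k; i'; k'] ->
  \sum_(S : {set 'I_n}) ((i \in S) == x)%:R * (((k \in S) == y)%:R *
    (((i' \in S) == x')%:R * ((k' \in S) == y')%:R)) = 16^-1 * NS.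
Proof.
rewrite /= !inE !negb_or => /and4P[/and3P[ik ii' ik'] /andP[ki' kk'] i'k' _].
rewrite sum_half => [|S]; last first.
  by rewrite !in_toggle !(eq_sym _ i) (negbTE ik) (negbTE ii') (negbTE ik') !addbF.
rewrite sum_half => [|S]; last first.
  by rewrite !in_toggle !(eq_sym _ k) (negbTE ki') (negbTE kk') !addbF.
by rewrite sum_ind2 //; field.
Qed.

(** Two distinct indices lie in a random [S] with probability 1/4, a single one with probability
    1/2; the zero sum cancels the common 1/4 and leaves 1/4 on the diagonal. *)
Lemma sum_subset_sqr (y : 'I_n -> R) : \sum_i y i = 0 ->
  \sum_(S : {set 'I_n}) (\sum_(i in S) y i) ^+ 2 = 4^-1 * NS * \sum_i y i ^+ 2.
Proof.
move=> y0.
transitivity (\sum_i \sum_k (\sum_(S : {set 'I_n}) (i \in S)%:R * (k \in S)%:R) * (y i * y k)).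
  under [RHS]eq_bigr => i _ do (under eq_bigr => k _ do rewrite mulr_suml; rewrite exchange_big /=).
  rewrite [RHS]exchange_big; apply: eq_bigr => S _ /=.
  rewrite expr2 mulr_suml sum_ind; apply: eq_bigr => i _.
  rewrite sum_ind !mulr_sumr; apply: eq_bigr => k _; ring.
rewrite mulr_sumr; apply: eq_bigr => i _; rewrite (bigD1 i) //=.
have -> : \sum_(S : {set 'I_n}) (i \in S)%:R * (i \in S)%:R = 2^-1 * NS.
  by rewrite -(sum_ind1 i true); apply: eq_bigr => S _; case: (i \in S); rewrite ?mul1r ?mul0r.
under eq_bigr => k ki.
  have -> : \sum_(S : {set 'I_n}) (i \in S)%:R * (k \in S)%:R = 4^-1 * NS.
    rewrite -(@sum_ind2 k i true true) 1?eq_sym //; apply: eq_bigr => S _.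
    by case: (i \in S); case: (k \in S).
  over.
rewrite -mulr_sumr -mulr_sumr; move: y0; rewrite (bigD1 i) //= => /eqP.
by rewrite addrC addr_eq0 => /eqP ->; field.
Qed.

Variable b : 'I_n -> 'I_n -> R.
Hypothesis brow0 : forall k, \sum_j b k j = 0.
Hypothesis bcol0 : forall j, \sum_k b k j = 0.
Hypothesis n_ge5 : (5 <= n)%N.

Let W := total b.
Let Bp p : 'I_n -> 'I_n -> R := fun i k => b i (p k).

Let n_gt0 : 0 < n%:R :> R. Proof. by rewrite ltr0n; lia. Qed.
Let n1_gt0 : 0 < n.-1%:R :> R. Proof. by rewrite ltr0n; lia. Qed.
Let W_ge0 : 0 <= W.
Proof. by apply: sumr_ge0 => i _; apply: sumr_ge0 => j _; apply: sqr_ge0. Qed.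

(** Distinct entries of a centred row, sampled without replacement, are negatively correlated, so
    only the diagonal terms of the squared row sums remain. *)
Lemma sum_brow_le S : \sum_(p : {perm 'I_n}) brow S (Bp p) <= #|S|%:R * ((n`!)%:R / n%:R * W).
Proof.
have F0 : 0 < (n`!)%:R :> R by rewrite ltr0n fact_gt0.
rewrite /brow exchange_big /=.
have term i : \sum_(p : {perm 'I_n}) (\sum_(k in S) b i (p k)) ^+ 2 <= #|S|%:R * ((n`!)%:R / n%:R * \sum_j b i j ^+ 2).
  have -> : \sum_(p : {perm 'I_n}) (\sum_(k in S) b i (p k)) ^+ 2 = \sum_(k in S) (\sum_(p : {perm 'I_n}) b i (p k) ^+ 2 +
      \sum_(m in S | m != k) \sum_(p : {perm 'I_n}) b i (p k) * b i (p m)).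
    transitivity (\sum_(p : {perm 'I_n}) \sum_(k in S) (b i (p k) ^+ 2 + \sum_(m in S | m != k) b i (p k) * b i (p m))).
      apply: eq_bigr => p _; rewrite {1}expr2 mulr_suml; apply: eq_bigr => k kS.
      by rewrite -mulr_sumr sum_neq // mulrBr expr2 addrC subrK.
    rewrite exchange_big; apply: eq_bigr => k _; rewrite big_split; congr (_ + _).
    by rewrite exchange_big.
  rewrite [X in _ <= X]mulr_natl -sumr_const; apply: ler_sum => k kS.
  have -> : \sum_(p : {perm 'I_n}) b i (p k) ^+ 2 = (n`!)%:R / n%:R * \sum_j b i j ^+ 2.
    have := sum_image1 k (fun l => b i l ^+ 2); move=> H.
    by rewrite mulrAC -H; field; rewrite gt_eqF.
  rewrite -[X in _ <= X]addr0 lerD2l; apply: sumr_le0 => m /andP[mS mk].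
  have := sum_image2 (fun l j => b i l * b i j) (_ : k != m); rewrite eq_sym => /(_ mk) H.
  rewrite -(pmulr_rle0 _ (_ : 0 < (n * n.-1)%:R)) ?natrM ?mulr_gt0 // -natrM H pmulr_rle0 //.
  apply: sumr_le0 => l _; rewrite -mulr_sumr.
  have := brow0 i; rewrite (bigD1 l) //= => /eqP; rewrite addrC addr_eq0 => /eqP ->.
  by rewrite mulrN oppr_le0 -expr2 sqr_ge0.
apply: (@le_trans _ _ (\sum_(i in S) #|S|%:R * ((n`!)%:R / n%:R * \sum_j b i j ^+ 2))).
  by apply: ler_sum => i _; apply: term.
rewrite -mulr_sumr ler_wpM2l // -mulr_sumr ler_wpM2l ?divr_ge0 //.
rewrite /W /total [X in _ <= X](bigID (mem S)) /= -[X in X <= _]addr0 lerD2l.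
by apply: sumr_ge0 => i _; apply: sumr_ge0 => j _; apply: sqr_ge0.
Qed.

Lemma sum_bcol S : \sum_(p : {perm 'I_n}) bcol S (Bp p) =
  #|S|%:R * ((n`!)%:R / n%:R * \sum_j (\sum_(i in S) b i j) ^+ 2).
Proof.
rewrite /bcol exchange_big /= [RHS]mulr_natl -sumr_const; apply: eq_bigr => k _.
have := sum_image1 k (fun l => (\sum_(i in S) b i l) ^+ 2); move=> H.
by rewrite mulrAC -H; field; rewrite gt_eqF.
Qed.

(** The row part is bounded for each [S] separately. The column part is small only on average over
    [S], through [sum_subset_sqr] applied to each centred column. *)
Lemma sum_corr_le :
  \sum_(S : {set 'I_n}) \sum_(p : {perm 'I_n}) corr S (Bp p) <= NS * (n`!)%:R * (2 * W / n%:R).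
Proof.
have F0 : 0 < (n`!)%:R :> R by rewrite ltr0n fact_gt0.
have Fn0 : 0 <= (n`!)%:R / n%:R :> R by rewrite divr_ge0.
apply: (@le_trans _ _ (\sum_(S : {set 'I_n}) ((n`!)%:R / n%:R * W +
    (n`!)%:R / n%:R * \sum_j (\sum_(i in S) b i j) ^+ 2))).
  apply: ler_sum => S _; rewrite /corr -mulr_suml big_split /=.
  case: (posnP #|S|) => [->|Sp].
    rewrite invr0 mulr0 addr_ge0 // mulr_ge0 //.
    by apply: sumr_ge0 => j _; apply: sqr_ge0.
  have S0 : 0 < #|S|%:R :> R by rewrite ltr0n.
  by rewrite ler_pdivrMr // sum_bcol mulrDl lerD // mulrC // sum_brow_le.
rewrite big_split /= sumr_const -[_ *+ _]mulr_natl -/NS -mulr_sumr exchange_big /=.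
rewrite (eq_bigr (fun j => 4^-1 * NS * \sum_i b i j ^+ 2)) => [|j _]; last exact: sum_subset_sqr.
rewrite -mulr_sumr exchange_big -/(total b) -/W.
have NF : 0 <= NS * ((n`!)%:R / n%:R * W) by apply: mulr_ge0; [rewrite /NS ler0n | apply: mulr_ge0].
have -> : NS * (n`!)%:R * (2 * W / n%:R) = 2 * (NS * ((n`!)%:R / n%:R * W)).
  by field; rewrite gt_eqF.
have -> : (n`!)%:R / n%:R * (4^-1 * NS * W) = 4^-1 * (NS * ((n`!)%:R / n%:R * W)).
  by field; rewrite gt_eqF.
by lra.
Qed.

(** For a weight matrix this is the mass on ordered pairs of entries in distinct rows and distinct
    columns. Summing over [[set: 'I_n]] makes it an instance of [sum_offdiag]. *)
Definition theta B : R :=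
  \sum_(i in [set: 'I_n]) \sum_(k in [set: 'I_n] | k != i) \sum_(l in [set: 'I_n])
  \sum_(m in [set: 'I_n] | m != l) B i l * B k m.

Lemma thetaE B :
  theta B = \sum_i \sum_(k | k != i) \sum_l \sum_(m | m != l) B i l * B k m.
Proof.
apply: eq_big => [i|i _]; first by rewrite inE.
apply: eq_big => [k|k _]; first by rewrite inE.
apply: eq_big => [l|l _]; first by rewrite inE.
by apply: eq_bigl => m; rewrite inE.
Qed.

Let w i j := b i j ^+ 2.
Let cross i k := \sum_l \sum_(m | m != l) w i l * w k m.

Let cross_ge0 i k : 0 <= cross i k.
Proof.
by apply: sumr_ge0 => l _; apply: sumr_ge0 => m _; rewrite mulr_ge0 // sqr_ge0.
Qed.

Let theta_cross : theta w = \sum_i \sum_(k | k != i) cross i k.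
Proof. exact: thetaE. Qed.

Lemma theta_ge0 : 0 <= theta w.
Proof. by rewrite theta_cross; apply: sumr_ge0 => i _; apply: sumr_ge0. Qed.

Let card_uniq4 i i' : i' != i ->
  \sum_k \sum_k' (uniq [:: i; k; i'; k'])%:R = (n - 2)%:R * (n - 3)%:R :> R.
Proof.
move=> ii'.
have c2 : #|~: [set i; i']| = (n - 2)%N.
  by have := cardsC [set i; i']; rewrite card_ord cards2 eq_sym ii'; lia.
have c3 k : k \in ~: [set i; i'] -> #|~: (k |: [set i; i'])| = (n - 3)%N.
  rewrite inE => kS; have := cardsC (k |: [set i; i']).
  by rewrite card_ord cardsU1 kS cards2 eq_sym ii'; lia.
transitivity (\sum_k (k \in ~: [set i; i'])%:R * (n - 3)%:R : R).
  apply: eq_bigr => k _; case: (boolP (k \in ~: [set i; i'])) => kC; last first.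
    rewrite mul0r big1 // => k' _; suff -> : uniq [:: i; k; i'; k'] = false by [].
    move: kC; rewrite !inE negbK => /orP[] /eqP -> /=; rewrite !inE eqxx ?orbT //=.
    by rewrite andbF.
  rewrite mul1r -(c3 k kC) -[RHS]mulr1 mulr_natl -sumr_const [RHS]big_mkcond.
  apply: eq_bigr => k' _; move: kC; rewrite /= !inE !negb_or andbT => /andP[ki ki'].
  rewrite (eq_sym i k) ki (eq_sym i i') ii' ki' /=.
  by rewrite (eq_sym i k') (eq_sym k k') (eq_sym i' k'); case: (k' == i); case: (k' == k); case: (k' == i').
by rewrite -mulr_suml -c2 -sum1_card natr_sum [X in _ = X * _]sum_ind; under [in RHS]eq_bigr do rewrite mulr1.
Qed.

(** Expand the product into terms with [i], [k] in [S] and [i'], [k'] outside, and keep only four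
    distinct indices, a pattern of probability 1/16. A random [p] then makes [(p k, p k')] a uniform
    ordered pair of distinct columns. *)
Lemma sum_bsq_ge : NS * (n`!)%:R * theta w <=
  64 * \sum_(S : {set 'I_n}) \sum_(p : {perm 'I_n}) bsq S (Bp p) * bsq (~: S) (Bp p).
Proof.
pose ind i k i' k' (S : {set 'I_n}) : R := ((i \in S) == true)%:R * (((k \in S) == true)%:R *
    (((i' \in S) == false)%:R * ((k' \in S) == false)%:R)).
have N0 : 0 <= NS by rewrite /NS ler0n.
have step1 S p : bsq S (Bp p) * bsq (~: S) (Bp p) =
    \sum_i \sum_i' \sum_k \sum_k' ind i k i' k' S * (w i (p k) * w i' (p k')).
  rewrite /bsq sum_ind mulr_suml; apply: eq_bigr => i _.
  rewrite [X in _ * X]sum_ind mulr_sumr; apply: eq_bigr => i' _; rewrite !sum_ind mulrACA big_distrlr mulr_sumr.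
  apply: eq_bigr => k _; rewrite mulr_sumr; apply: eq_bigr => k' _.
  by rewrite /ind !inE !eqb_id !eqbF_neg /w /Bp /=; ring.
have step2 : \sum_i \sum_i' \sum_k \sum_k' (uniq [:: i; k; i'; k'])%:R * (16^-1 * NS) *
    (\sum_(p : {perm 'I_n}) w i (p k) * w i' (p k')) <=
    \sum_(S : {set 'I_n}) \sum_(p : {perm 'I_n}) bsq S (Bp p) * bsq (~: S) (Bp p).
  under [X in _ <= X]eq_bigr => S _ do under eq_bigr => p _ do rewrite step1.
  rewrite [X in _ <= X]exchange_big /=.
  have -> : \sum_(p : {perm 'I_n}) \sum_(S : {set 'I_n}) \sum_i \sum_i' \sum_k \sum_k'
      ind i k i' k' S * (w i (p k) * w i' (p k')) =
      \sum_i \sum_i' \sum_k \sum_k' (\sum_(S : {set 'I_n}) ind i k i' k' S) *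
      (\sum_(p : {perm 'I_n}) w i (p k) * w i' (p k')).
    under eq_bigr => p _ do rewrite exchange_big /=.
    rewrite exchange_big; apply: eq_bigr => i _ /=.
    under eq_bigr => p _ do rewrite exchange_big /=.
    rewrite exchange_big; apply: eq_bigr => i' _ /=.
    under eq_bigr => p _ do rewrite exchange_big /=.
    rewrite exchange_big; apply: eq_bigr => k _ /=.
    under eq_bigr => p _ do rewrite exchange_big /=.
    rewrite exchange_big; apply: eq_bigr => k' _ /=.
    by rewrite mulr_sumr; apply: eq_bigr => p _; rewrite mulr_suml.
  apply: ler_sum => i _; apply: ler_sum => i' _; apply: ler_sum => k _; apply: ler_sum => k' _.
  apply: ler_wpM2r.
    by apply: sumr_ge0 => p _; rewrite mulr_ge0 // sqr_ge0.
  rewrite -[X in nat_of_bool X]/(uniq [:: i; k; i'; k']).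
  case: (boolP (uniq [:: i; k; i'; k'])) => [u|_]; first by rewrite mul1r /ind sum_ind4.
  by rewrite mul0r; apply: sumr_ge0 => S _; rewrite /ind !mulr_ge0.
have step3 i i' : i' != i -> \sum_k \sum_k' (uniq [:: i; k; i'; k'])%:R * (16^-1 * NS) *
    (\sum_(p : {perm 'I_n}) w i (p k) * w i' (p k')) =
    (n - 2)%:R * (n - 3)%:R * (16^-1 * NS) * ((n`!)%:R / (n%:R * n.-1%:R) * cross i i').
  move=> ii'; rewrite -(card_uniq4 ii') !mulr_suml; apply: eq_bigr => k _.
  rewrite !mulr_suml; apply: eq_bigr => k' _.
  case: (boolP (uniq [:: i; k; i'; k'])) => [|_]; last by rewrite !mul0r.
  rewrite /= !inE !negb_or => /and4P[_ /andP[_ kk'] _ _]; congr (_ * _).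
  have := sum_image2 (fun l m => w i l * w i' m) kk'; rewrite -/(cross i i') natrM => H.
  by rewrite mulrAC -H; field; rewrite !gt_eqF.
(* The proportion of usable pairs [(k, k')] is at least 1/4 from [n = 5] on; together with the
   factor 16 this gives 64. *)
have cst : 1 <= 4 * ((n - 2)%:R * (n - 3)%:R / (n%:R * n.-1%:R)) :> R.
  rewrite mulrA ler_pdivlMr ?mulr_gt0 // mul1r -!natrM ler_nat; nia.
apply: (@le_trans _ _ (64 * (\sum_i \sum_(i' | i' != i)
    (n - 2)%:R * (n - 3)%:R * (16^-1 * NS) * ((n`!)%:R / (n%:R * n.-1%:R) * cross i i')))); last first.
  rewrite ler_pM2l //; apply: le_trans step2; apply: ler_sum => i _.
  rewrite [X in _ <= X](bigID (fun i' => i' != i)) /= -[X in X <= _]addr0; apply: lerD.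
    by apply: ler_sum => i' ii'; rewrite step3.
  do 3![apply: sumr_ge0 => ? _]; apply: mulr_ge0; first by rewrite mulr_ge0 ?ler0n // mulr_ge0 // invr_ge0.
  by apply: sumr_ge0 => p _; rewrite mulr_ge0 // sqr_ge0.
under [X in _ <= _ * X]eq_bigr => i _ do rewrite -!mulr_sumr.
rewrite -2!mulr_sumr -theta_cross.
have -> : 64 * ((n - 2)%:R * (n - 3)%:R * (16^-1 * NS) * ((n`!)%:R / (n%:R * n.-1%:R) * theta w)) =
   (4 * ((n - 2)%:R * (n - 3)%:R / (n%:R * n.-1%:R))) * (NS * (n`!)%:R * theta w).
  by field; rewrite !gt_eqF.
by rewrite -[X in X <= _]mul1r; apply: ler_wpM2r; rewrite // !mulr_ge0 // theta_ge0.
Qed.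

(** For each [S] the sum of [block_product_le] over [p] recovers the full squared error, every
    permutation being counted equally often. Averaging over [S] then combines [sum_bsq_ge] with
    [sum_corr_le]. *)
Lemma theta_le (A : {set {perm 'I_n}}) (c : R) : W <= n%:R ->
  (n`!)%:R * theta w <=
  64 * 352 * n%:R ^+ 2 * (\sum_(p : {perm 'I_n}) ((p \in A)%:R - (c + diagsum b p)) ^+ 2) +
  256 * ((n`!)%:R * (W ^+ 2 / n%:R)).
Proof.
move=> Wn; set E := \sum_p _.
have N0 : 0 < NS by rewrite /NS ltr0n; apply/card_gt0P; exists setT.
have perS S : \sum_(p : {perm 'I_n}) (bsq S (Bp p) * bsq (~: S) (Bp p) -
    W * (corr S (Bp p) + corr (~: S) (Bp p))) <= 352 * n%:R ^+ 2 * E.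
  have M0 : 0 < (#|S|`! * #|~: S|`!)%:R :> R by rewrite ltr0n muln_gt0 !fact_gt0.
  rewrite -(ler_pM2l M0) mulr_sumr.
  apply: (@le_trans _ _ (\sum_p 352 * n%:R ^+ 2 * coset_error A c b S p)).
    by apply: ler_sum => p _; apply: block_product_le.
  by rewrite -mulr_sumr sum_coset_error -/E mulrCA.
have sumS : \sum_(S : {set 'I_n}) \sum_(p : {perm 'I_n}) bsq S (Bp p) * bsq (~: S) (Bp p) <=
    NS * (352 * n%:R ^+ 2 * E) + W * (2 * (NS * (n`!)%:R * (2 * W / n%:R))).
  have cC : \sum_(S : {set 'I_n}) \sum_(p : {perm 'I_n}) corr (~: S) (Bp p) =
      \sum_(S : {set 'I_n}) \sum_(p : {perm 'I_n}) corr S (Bp p).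
    by rewrite [RHS](reindex_inj (@setC_inj _)).
  have : \sum_(S : {set 'I_n}) \sum_(p : {perm 'I_n}) (bsq S (Bp p) * bsq (~: S) (Bp p) -
      W * (corr S (Bp p) + corr (~: S) (Bp p))) <= \sum_(S : {set 'I_n}) 352 * n%:R ^+ 2 * E.
    by apply: ler_sum => S _; apply: perS.
  rewrite sumr_const -[X in _ <= X]mulr_natl -/NS.
  under eq_bigr => S _ do rewrite sumrB -mulr_sumr big_split /=.
  rewrite sumrB -mulr_sumr big_split /= cC => H.
  have := ler_wpM2l W_ge0 sum_corr_le; lra.
have H := sum_bsq_ge; rewrite -(ler_pM2l N0).
apply: (@le_trans _ _ (64 * (NS * (352 * n%:R ^+ 2 * E) + W * (2 * (NS * (n`!)%:R * (2 * W / n%:R)))))).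
  by rewrite [X in X <= _]mulrA; apply: (le_trans H); rewrite ler_pM2l.
by rewrite le_eqVlt; apply/orP; left; apply/eqP; field; rewrite gt_eqF.
Qed.

End Averaging.

(** * From a concentrated weight matrix to a dictatorship *)

Section Concentration.
Variables (R : rcfType) (n : nat).
Implicit Types (p q s t : {perm 'I_n}) (i j k l m : 'I_n).

(** Let [r] and [d] be the heaviest row and column sums and [x] the entry where they cross.
    Inclusion-exclusion gives [r + d >= W - T / W], and the pairs with one entry in that row and one
    in that column, both off the crossing, give [(r - x)(d - x) <= T]. So the smaller of [r], [d] is
    at most [8 T / W + 1], and the larger carries the rest. *)
Lemma theta_concentrated (w : 'I_n -> 'I_n -> R) (W : R) :
  (forall i j, 0 <= w i j <= 1) -> W = \sum_i \sum_j w i j -> 8 <= W -> 2 * theta w <= W ^+ 2 ->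
  (exists i, W - 9 * (theta w / W) - 1 <= \sum_j w i j) \/
  (exists j, W - 9 * (theta w / W) - 1 <= \sum_i w i j).
Proof.
move=> w01 WE W8 thW; set T := theta w in thW *.
pose r i := \sum_j w i j; pose d j := \sum_i w i j.
have w0 i j : 0 <= w i j by case/andP: (w01 i j).
have [i _] : exists i : 'I_n, true.
  case: (pickP (fun _ : 'I_n => true)) => [i _|no]; first by exists i.
  by move: W8; rewrite WE big_pred0 // => H; exfalso; lra.
case: (@Order.TotalTheory.arg_maxP _ _ _ i xpredT r isT) => i0 _ rmax.
case: (@Order.TotalTheory.arg_maxP _ _ _ i xpredT d isT) => j0 _ dmax.
have TE : T = W ^+ 2 - \sum_i r i ^+ 2 - \sum_j d j ^+ 2 + \sum_i \sum_j w i j ^+ 2.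
  rewrite /T /theta sum_offdiag WE /bsum /brow /bcol /bsq.
  have inT (V : nmodType) (F : 'I_n -> V) : \sum_(i in [set: 'I_n]) F i = \sum_i F i.
    by apply: eq_bigl => x; rewrite inE.
  rewrite !inT; congr (_ ^+ 2 - _ - _ + _).
  - by apply: eq_bigr => x _; rewrite inT.
  - by apply: eq_bigr => x _; rewrite inT.
  - by apply: eq_bigr => x _; rewrite inT.
  - by apply: eq_bigr => x _; rewrite inT.
have r0 x : 0 <= r x by apply: sumr_ge0.
have d0 x : 0 <= d x by apply: sumr_ge0.
have sumr : \sum_x r x ^+ 2 <= r i0 * W.
  rewrite WE mulr_sumr; apply: ler_sum => x _; rewrite expr2; apply: ler_wpM2r; [exact: r0|exact: rmax].
have sumd : \sum_x d x ^+ 2 <= d j0 * W.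
  rewrite WE exchange_big mulr_sumr; apply: ler_sum => x _; rewrite expr2.
  by apply: ler_wpM2r; [exact: d0|exact: dmax].
have sumw : 0 <= \sum_x \sum_j w x j ^+ 2.
  by apply: sumr_ge0 => x _; apply: sumr_ge0 => j _; apply: sqr_ge0.
have rw : r i0 = w i0 j0 + \sum_(j | j != j0) w i0 j by rewrite /r (bigD1 j0).
have dw : d j0 = w i0 j0 + \sum_(k | k != i0) w k j0 by rewrite /d (bigD1 i0).
have prodT : (r i0 - w i0 j0) * (d j0 - w i0 j0) <= T.
  rewrite rw dw ![w i0 j0 + _]addrC !addrK /T thetaE [X in _ <= X](bigD1 i0) //= -[X in X <= _]addr0.
  apply: lerD; last first.
    by do 4![apply: sumr_ge0 => ? _]; rewrite mulr_ge0.
  rewrite mulrC mulr_suml; apply: ler_sum => k _; rewrite [X in _ <= X](bigD1 j0) //= addrC.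
  rewrite mulr_sumr -[X in X <= _]addr0; apply: lerD; last first.
    by apply: sumr_ge0 => ? _; rewrite mulr_ge0.
  apply: ler_sum => j jj0; rewrite (bigD1 j0) ?(eq_sym j0) //= mulrC -[X in X <= _]addr0 lerD2l.
  by apply: sumr_ge0 => ? _; rewrite mulr_ge0.
have [/andP[x0 x1]] : 0 <= w i0 j0 <= 1 /\ True by [].
have rx : 0 <= r i0 - w i0 j0 by rewrite rw [w i0 j0 + _]addrC addrK sumr_ge0.
have dx : 0 <= d j0 - w i0 j0 by rewrite dw [w i0 j0 + _]addrC addrK sumr_ge0.
have key : W ^+ 2 <= T + (r i0 + d j0) * W by move: TE sumr sumd sumw; rewrite mulrDl; lra.
have concl (a b x : R) : 0 <= x -> x <= 1 -> 0 <= a - x -> 0 <= b - x -> b <= a ->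
    (a - x) * (b - x) <= T -> W ^+ 2 <= T + (a + b) * W -> W - 9 * (T / W) - 1 <= a.
  move=> x0' x1' ax bx ba prd k2.
  have Wp : 0 < W by lra.
  have TW : T = T / W * W by field; rewrite gt_eqF.
  set u := T / W in TW *.
  have u2 : 2 * u <= W.
    by rewrite -(ler_pM2r Wp); move: thW; rewrite {1}TW expr2; lra.
  have ab : W - u <= a + b by rewrite -(ler_pM2r Wp); move: k2; rewrite {1}TW expr2; lra.
  (* The larger sum is at least [W / 4], and [W >= 8] absorbs [x <= 1]. *)
  have aW : W / 8 <= a - x by lra.
  have bxu : b - x <= 8 * u.
    have h1 : W / 8 * (b - x) <= u * W by rewrite -TW; apply: le_trans prd; apply: ler_wpM2r.
    by rewrite -(ler_pM2r Wp); lra.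
  lra.
move=> _; case: (lerP (d j0) (r i0)) => [dr|/ltW rd].
  by left; exists i0; apply: (concl _ (d j0) (w i0 j0)).
right; exists j0; apply: (concl _ (r i0) (w i0 j0)) => //; first by rewrite mulrC.
by rewrite [d j0 + _]addrC.
Qed.

End Concentration.

(** * The edge boundary as an upper bound for the Dirichlet form *)

Section Boundary.
Variables (R : rcfType) (n : nat) (A : {set {perm 'I_n}}).
Implicit Types (p q s t : {perm 'I_n}) (i j k l m : 'I_n).

Definition indic p : R := (p \in A)%:R.

(** A transposition comes from exactly two ordered pairs; [q != p] rules out the pairs with
    [i = k]. *)
Lemma sum_tperm_le2 p q : q != p ->
  \sum_i \sum_k (q == tperm i k * p)%g%:R <=
  2 * [exists i : 'I_n, exists j : 'I_n, (i != j) && (p * q^-1 == tperm i j)%g]%:R :> R.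
Proof.
move=> qp; have mulE i k : (q == tperm i k * p)%g = (p * q^-1 == tperm i k)%g.
  apply/eqP/eqP => [->|E]; first by rewrite invMg tpermV mulgA mulgV mul1g.
  by rewrite -tpermV -E invMg invgK -mulgA mulVg mulg1.
case: existsP => [[i0 /existsP[k0 /andP[ik0 /eqP E0]]]|no]; last first.
  rewrite mulr0 big1 // => i _; apply: big1 => k _; case: eqP => // /eqP qE; case: no.
  exists i; apply/existsP; exists k; rewrite -mulE qE andbT.
  by apply: contraNneq qp => ik; rewrite (eqP qE) ik tperm1 mul1g.
rewrite mulr1; apply: (@le_trans _ _ (\sum_i \sum_k ((i == i0)%:R * (k == k0)%:R +
    (i == k0)%:R * (k == i0)%:R))).
  apply: ler_sum => i _; apply: ler_sum => k _; rewrite mulE E0.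
  case: eqP => [tE|_]; last by rewrite addr_ge0 // mulr_ge0.
  have := congr1 (fun s : {perm 'I_n} => s i0) tE; rewrite /= tpermL.
  case: tpermP => [-> <-|-> <-|_ _ ki]; rewrite ?eqxx ?mul1r ?mulr1.
  - by rewrite lerDl mulr_ge0.
  - by rewrite lerDr mulr_ge0.
  - by rewrite ki eqxx in ik0.
have D x : \sum_i (i == x)%:R = 1 :> R.
  by rewrite (bigD1 x) //= eqxx big1 ?addr0 // => i /negbTE ->.
under eq_bigr => i _ do rewrite big_split /= -!mulr_sumr !D !mulr1.
by rewrite big_split /= !D.
Qed.

(** Only [p] in [A] with a neighbour outside [A] contributes, and the factor 1/2 in [lap] offsets
    the two orderings of each transposition. *)
Lemma energy_le_boundary : \sum_p indic p * lap indic p <= #|boundary_edges A|%:R.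
Proof.
have -> : #|boundary_edges A|%:R = \sum_p \sum_q ((p, q) \in boundary_edges A)%:R :> R.
  rewrite pair_big /= -sum1_card natr_sum big_mkcond; apply: eq_bigr => -[p q] _ /=.
  by case: ((p, q) \in _).
apply: ler_sum => p _; rewrite /indic; case: (boolP (p \in A)) => pA; last first.
  by rewrite mul0r; apply: sumr_ge0.
rewrite mul1r /lap pA.
have -> : \sum_i \sum_k (true%:R - ((tperm i k * p)%g \in A)%:R) =
    \sum_(q | q \notin A) \sum_i \sum_k (q == tperm i k * p)%g%:R :> R.
  rewrite [RHS]exchange_big; apply: eq_bigr => i _; rewrite [RHS]exchange_big; apply: eq_bigr => k _ /=.
  case: (boolP (_ \in A)) => tA.
    by rewrite subrr big1 // => q qA; case: eqP => // qE; rewrite qE tA in qA.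
  rewrite subr0 (bigD1 (tperm i k * p)%g) //= eqxx big1 ?addr0 // => q /andP[_ /negbTE ->] //.
rewrite ler_pdivrMl // mulr_sumr big_mkcond; apply: ler_sum => q _.
case: (boolP (q \in A)) => qA /=; first by rewrite mulr_ge0.
rewrite inE /= pA qA; apply: sum_tperm_le2.
by apply: contraNneq qA => ->.
Qed.

End Boundary.

(** * Rounding fibre averages to a union of fibres *)

Section Rounding.
Variables (R : rcfType) (n : nat) (A : {set {perm 'I_n}}).
Implicit Types (p q s t : {perm 'I_n}) (i j k l m : 'I_n).

Lemma card_symdiff B : #|symdiff A B|%:R = \sum_p (indic R A p - indic R B p) ^+ 2 :> R.
Proof.
rewrite -sum1_card natr_sum big_mkcond; apply: eq_bigr => p _.
rewrite /symdiff !inE /indic.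
by case: (p \in A); case: (p \in B) => /=; rewrite ?subrr ?subr0 ?sub0r ?sqrrN ?expr1n ?expr0n.
Qed.

(** Where thresholding at 1/2 disagrees with [A], the indicator is at distance at least 1/2 from its
    fibre average, which explains the factor 4. What remains is the squared distance of the
    indicator to its conditional expectation given [key]. *)
Lemma round_symdiff_le (key : {perm 'I_n} -> 'I_n) (a : 'I_n -> R) (v : R) :
  (forall x, \sum_(p | key p == x) 1 = v) ->
  (forall x, \sum_(p | key p == x) indic R A p = v * a x) ->
  #|symdiff A [set p | 2^-1 <= a (key p)]|%:R <= 4 * (#|A|%:R - v * \sum_x a x ^+ 2).
Proof.
move=> v1 va; rewrite card_symdiff.
apply: (@le_trans _ _ (\sum_p 4 * (indic R A p - a (key p)) ^+ 2)).
  apply: ler_sum => p _; rewrite /indic inE.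
  case: (p \in A); case: (lerP 2^-1 (a (key p))) => h /=.
  - by rewrite subrr expr0n /= mulr_ge0 // sqr_ge0.
  - by rewrite subr0 expr1n; nra.
  - by rewrite sub0r sqrrN expr1n; nra.
  - by rewrite subrr expr0n /= mulr_ge0 // sqr_ge0.
rewrite -mulr_sumr ler_pM2l // le_eqVlt; apply/orP; left; apply/eqP.
have part (F : {perm 'I_n} -> R) : \sum_p F p = \sum_x \sum_(p | key p == x) F p.
  by rewrite (partition_big key xpredT).
have fA : \sum_p indic R A p ^+ 2 = #|A|%:R.
  rewrite -sum1_card natr_sum [RHS]big_mkcond; apply: eq_bigr => p _; rewrite /indic.
  by case: (p \in A); rewrite ?expr1n ?expr0n.
have fa : \sum_p indic R A p * a (key p) = v * \sum_x a x ^+ 2.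
  rewrite part mulr_sumr; apply: eq_bigr => x _.
  rewrite (eq_bigr (fun p => indic R A p * a x)) => [|p /eqP -> //].
  by rewrite -mulr_suml va expr2 mulrA.
have aa : \sum_p a (key p) ^+ 2 = v * \sum_x a x ^+ 2.
  rewrite part mulr_sumr; apply: eq_bigr => x _.
  rewrite (eq_bigr (fun p => 1 * a x ^+ 2)) => [|p /eqP ->]; last by rewrite mul1r.
  by rewrite -mulr_suml v1.
under eq_bigr => p _ do rewrite sqrrB -[_ *+ 2]mulr_natl.
rewrite big_split sumrB /= -mulr_sumr fa aa fA; ring.
Qed.

End Rounding.

(** * Norm and energy identities for the indicator, and the choice of a dictatorship *)

Section Main.
Variables (R : rcfType) (n : nat) (A : {set {perm 'I_n}}).
Implicit Types (p q s t : {perm 'I_n}) (i j k l m : 'I_n).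
Hypothesis n_ge5 : (5 <= n)%N.

Let n_gt1 : (1 < n)%N. Proof. by lia. Qed.
Let n_gt0 : 0 < n%:R :> R. Proof. by rewrite ltr0n; lia. Qed.
Let n1_gt0 : 0 < n.-1%:R :> R. Proof. by rewrite ltr0n; lia. Qed.
Let fact_gt0 (a : nat) : 0 < (a`!)%:R :> R. Proof. by rewrite ltr0n fact_gt0. Qed.
Let factE : (n`!)%:R = n%:R * (n.-1`!)%:R :> R.
Proof. by rewrite -natrM; congr (_%:R); case: (n) n_gt1. Qed.

Let f := indic R A.
Let c := mean f.
Let b := coef f.
Let W := total b.
Let E := \sum_p rest f p ^+ 2.
Let br k : \sum_j b k j = 0. Proof. exact: coef_row. Qed.
Let bc j : \sum_k b k j = 0. Proof. exact: coef_col. Qed.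

Let sum_f : \sum_p f p = (n`!)%:R * c.
Proof. by rewrite /c /mean mulVKf // gt_eqF. Qed.

Let card_A : #|A|%:R = (n`!)%:R * c :> R.
Proof.
rewrite -sum_f -sum1_card natr_sum big_mkcond; apply: eq_bigr => p _.
by rewrite /f /indic; case: (p \in A).
Qed.

Let sum_f2 : \sum_p f p ^+ 2 = (n`!)%:R * c.
Proof.
by rewrite -sum_f; apply: eq_bigr => p _; rewrite /f /indic; case: (p \in A); rewrite ?expr1n ?expr0n.
Qed.

Let bdiagT s : bdiag setT b s = diagsum b s.
Proof. by apply: eq_bigl => i; rewrite inE. Qed.

Let sumT (F : 'I_n -> R) : \sum_(i in [set: 'I_n]) F i = \sum_i F i.
Proof. by apply: eq_bigl => i; rewrite inE. Qed.

Let sum_permT (F : {perm 'I_n} -> R) : \sum_(s | perm_on setT s) F s = \sum_s F s.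
Proof. by apply: eq_bigl => s; rewrite perm_onT. Qed.

Let bsumT : bsum setT b = 0.
Proof. by rewrite /bsum sumT big1 // => i _; rewrite sumT br. Qed.

Let sum_diagsum : \sum_p diagsum b p = 0.
Proof.
have := sum_bdiag setT b; rewrite bsumT mulr0 cardsT card_ord sum_permT.
under eq_bigr => s _ do rewrite bdiagT.
by move/eqP; rewrite mulf_eq0 gt_eqF //= => /eqP.
Qed.

Let sum_diagsum2 : \sum_p diagsum b p ^+ 2 = (n`!)%:R * (W / n.-1%:R).
Proof.
have T1 : (1 < #|[set: 'I_n]|)%N by rewrite cardsT card_ord.
have := sum_bdiag_sqr b T1; rewrite bsumT cardsT card_ord sum_permT.
under eq_bigr => s _ do rewrite bdiagT.
have -> : brow setT b = 0 by rewrite /brow sumT big1 // => i _; rewrite sumT br expr0n.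
have -> : bcol setT b = 0 by rewrite /bcol sumT big1 // => i _; rewrite sumT bc expr0n.
have -> : bsq setT b = W by rewrite /bsq sumT; apply: eq_bigr => i _; rewrite sumT.
rewrite expr0n /= !subr0 addr0 => H.
have H2 : \sum_i diagsum b i ^+ 2 = (n`!)%:R * (n%:R * W) / (n%:R * n.-1%:R).
  by rewrite -H; field; rewrite !gt_eqF.
by rewrite H2; field; rewrite !gt_eqF.
Qed.

(** The constant, [diagsum b] and [rest f] are mutually orthogonal, and an indicator equals its
    square. *)
Let pythagoras : W / n.-1%:R = c * (1 - c) - E / (n`!)%:R.
Proof.
have H : \sum_p f p ^+ 2 = E + (n`!)%:R * c ^+ 2 + (n`!)%:R * (W / n.-1%:R).
  have o := flat_orth n_gt1 b c (flat_rest n_gt1 f).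
  rewrite -sum_diagsum2 /E.
  transitivity (\sum_p (rest f p ^+ 2 + 2 * (rest f p * (c + diagsum b p)) +
     c ^+ 2 + 2 * c * diagsum b p + diagsum b p ^+ 2)).
    by apply: eq_bigr => p _; rewrite (decompE f p) -/c -/b; ring.
  have e1 : \sum_p 2 * (rest f p * (c + diagsum b p)) = 0 by rewrite -mulr_sumr o mulr0.
  have e2 : \sum_p 2 * c * diagsum b p = 0 by rewrite -mulr_sumr sum_diagsum mulr0.
  by rewrite !big_split /= e1 e2 !addr0 sumr_const card_Sn mulr_natl.
rewrite sum_f2 in H.
have F0 := fact_gt0 n.
apply: (mulfI (lt0r_neq0 F0)); rewrite mulrBr [_ * (E / _)]mulrC divfK ?gt_eqF //.
by move: H; nra.
Qed.

(** The Laplacian acts as [n] on [diagsum b] and is bounded below by [second_gap] on [rest f]; all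
    cross terms vanish by [flat_orth]. *)
Let energy : n%:R * ((n`!)%:R * (W / n.-1%:R)) + (n.-1 * 2)%:R * E <= #|boundary_edges A|%:R.
Proof.
apply: le_trans (energy_le_boundary R A); rewrite -/f.
have -> : \sum_p f p * lap f p = n%:R * (\sum_p diagsum b p ^+ 2) + \sum_p rest f p * lap (rest f) p.
  have o := flat_orth n_gt1 b c (flat_rest n_gt1 f).
  have oL := flat_orth n_gt1 b c (flat_lap (flat_rest n_gt1 f)).
  have o0 := flat_orth n_gt1 b 0 (flat_rest n_gt1 f).
  transitivity (\sum_p (rest f p * lap (rest f) p + lap (rest f) p * (c + diagsum b p) +
    n%:R * (rest f p * (0 + diagsum b p)) + n%:R * c * diagsum b p + n%:R * diagsum b p ^+ 2)).
    by apply: eq_bigr => p _; rewrite (lap_decomp n_gt1) {1}(decompE f p) -/c -/b; ring.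
  have e1 : \sum_p n%:R * (rest f p * (0 + diagsum b p)) = 0 by rewrite -mulr_sumr o0 mulr0.
  have e2 : \sum_p n%:R * c * diagsum b p = 0 by rewrite -mulr_sumr sum_diagsum mulr0.
  by rewrite !big_split /= oL e1 e2 -mulr_sumr !addr0 addrC.
by rewrite -sum_diagsum2 lerD2l; exact: (second_gap n_gt1 (flat_rest n_gt1 f)).
Qed.

Let c01 : 0 <= c <= 1.
Proof.
have F0 := fact_gt0 n.
apply/andP; split; first by rewrite -(pmulr_rge0 _ F0) -card_A ler0n.
rewrite -(ler_pM2l F0) -card_A mulr1 ler_nat.
by rewrite -card_Sn -cardsT subset_leq_card // subsetT.
Qed.

Let sum_fiber i j : \sum_(p : {perm 'I_n} | p i == j) 1 = (n.-1`!)%:R :> R.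
Proof.
have := sum_image1 i (fun l => (l == j)%:R : R).
have -> : \sum_l (l == j)%:R = 1 :> R.
  by rewrite (bigD1 j) //= eqxx big1 ?addr0 // => l /negbTE ->.
rewrite mulr1 factE => /(mulfI (lt0r_neq0 n_gt0)) <-.
by rewrite big_mkcond; apply: eq_bigr => p _; case: eqP.
Qed.

Let sum_fiber_f i j : \sum_(p : {perm 'I_n} | p i == j) f p = (n.-1`!)%:R * cell f i j.
Proof. by rewrite /cell mulVKf // gt_eqF. Qed.

Let cell01 i j : 0 <= cell f i j <= 1.
Proof.
have F0 := fact_gt0 n.-1.
apply/andP; split.
  rewrite -(pmulr_rge0 _ F0) -sum_fiber_f.
  by apply: sumr_ge0 => p _; rewrite /f /indic ler0n.
rewrite -(ler_pM2l F0) mulr1 -sum_fiber_f -(sum_fiber i j).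
by apply: ler_sum => p _; rewrite /f /indic lern1 leq_b1.
Qed.

Let b2_le1 i j : 0 <= b i j ^+ 2 <= 1.
Proof.
rewrite sqr_ge0 /= /b /coef -/c; set r := _ / _.
have r0 : 0 <= r by rewrite divr_ge0 // ltW.
have r1 : r <= 1 by rewrite /r ler_pdivrMr // mul1r ler_nat leq_pred.
have /andP[a0 a1] := cell01 i j; have /andP[c0 c1] := c01.
rewrite exprMn -[X in _ <= X]mulr1; apply: ler_pM; rewrite ?sqr_ge0 //.
  by rewrite expr_le1.
by nra.
Qed.

Let cell_coef i j : cell f i j = c + n%:R / n.-1%:R * b i j.
Proof. by rewrite /b /coef -/c; field; rewrite !gt_eqF. Qed.

(** The exact value carries an extra factor [n / (n-1)] on the sum of squares; being at least 1 and
    subtracted, it may be replaced by 1. *)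
Let round_bound (v : 'I_n -> R) (u : 'I_n -> R) :
  (forall x, v x = c + n%:R / n.-1%:R * u x) -> \sum_x u x = 0 ->
  4 * (#|A|%:R - (n.-1`!)%:R * \sum_x v x ^+ 2) <=
  4 * ((n`!)%:R * (c * (1 - c) - (\sum_x u x ^+ 2) / n.-1%:R)).
Proof.
move=> vE u0; rewrite ler_pM2l //.
have -> : \sum_x v x ^+ 2 = n%:R * c ^+ 2 + (n%:R / n.-1%:R) ^+ 2 * \sum_x u x ^+ 2.
  transitivity (\sum_x (c ^+ 2 + 2 * c * (n%:R / n.-1%:R) * u x +
      (n%:R / n.-1%:R) ^+ 2 * u x ^+ 2)).
    by apply: eq_bigr => x _; rewrite vE; ring.
  have e1 : \sum_x 2 * c * (n%:R / n.-1%:R) * u x = 0 by rewrite -mulr_sumr u0 mulr0.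
  by rewrite !big_split /= e1 addr0 sumr_const card_ord mulr_sumr [n%:R * c ^+ 2]mulr_natl.
have U0 : 0 <= \sum_x u x ^+ 2 by apply: sumr_ge0 => x _; apply: sqr_ge0.
move: (\sum_x u x ^+ 2) U0 => U U0; rewrite card_A factE.
have -> : n%:R * (n.-1`!)%:R * c - (n.-1`!)%:R * (n%:R * c ^+ 2 + (n%:R / n.-1%:R) ^+ 2 * U) =
   n%:R * (n.-1`!)%:R * (c * (1 - c) - n%:R / n.-1%:R * (U / n.-1%:R)).
  by field; rewrite !gt_eqF.
rewrite ler_pM2l ?mulr_gt0 // lerD2l lerN2 -[X in X <= _]mul1r.
apply: ler_wpM2r; first by rewrite divr_ge0 // ltW.
by rewrite ler_pdivlMr // mul1r ler_nat leq_pred.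
Qed.

(** The union of the T_ij whose cell average is at least 1/2 is a threshold set for the key [p i];
    within one row these sets are disjoint. *)
Lemma row_dictatorship i : exists B, dictatorship B /\
  #|symdiff A B|%:R <= 4 * ((n`!)%:R * (c * (1 - c) - (\sum_j b i j ^+ 2) / n.-1%:R)).
Proof.
exists [set p : {perm 'I_n} | 2^-1 <= cell f i (p i)]; split.
  exists [set ij | (ij.1 == i) && (2^-1 <= cell f i ij.2)]; split.
    move=> [i1 j1] [i2 j2]; rewrite !inE /= => /andP[/eqP -> _] /andP[/eqP -> _] ne.
    rewrite disjoint_subset; apply/subsetP => p; rewrite !inE => /eqP pj.
    by apply: contraNneq ne => pj2; rewrite -pj -pj2.
  apply/setP => p; rewrite inE; apply/idP/bigcupP => [h|[[i1 j1]]].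
    by exists (i, p i); rewrite !inE /= ?eqxx.
  by rewrite !inE /= => /andP[/eqP -> h] /eqP ->.
apply: le_trans (round_symdiff_le (key := fun p : {perm 'I_n} => p i) (sum_fiber i) (sum_fiber_f i)) _.
by apply: round_bound => [x|]; [apply: cell_coef | apply: br].
Qed.

Lemma col_dictatorship j : exists B, dictatorship B /\
  #|symdiff A B|%:R <= 4 * ((n`!)%:R * (c * (1 - c) - (\sum_i b i j ^+ 2) / n.-1%:R)).
Proof.
have inv_eq p i : (p^-1%g j == i) = (p i == j).
  by apply/eqP/eqP => <-; rewrite ?permK ?permKV.
exists [set p : {perm 'I_n} | 2^-1 <= cell f (p^-1%g j) j]; split.
  exists [set ij | (ij.2 == j) && (2^-1 <= cell f ij.1 j)]; split.
    move=> [i1 j1] [i2 j2]; rewrite !inE /= => /andP[/eqP -> _] /andP[/eqP -> _] ne.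
    rewrite disjoint_subset; apply/subsetP => p; rewrite !inE => /eqP pj.
    by apply: contraNneq ne => pj2; rewrite -(@perm_inj _ p i1 i2) // pj pj2.
  apply/setP => p; rewrite inE; apply/idP/bigcupP => [h|[[i1 j1]]].
    by exists (p^-1%g j, j); rewrite !inE /= ?eqxx // permKV.
  by rewrite !inE /= => /andP[/eqP -> h]; rewrite -inv_eq => /eqP ->.
have s1 i : \sum_(p : {perm 'I_n} | p^-1%g j == i) 1 = (n.-1`!)%:R :> R.
  by rewrite -(sum_fiber i j); apply: eq_bigl => p; rewrite inv_eq.
have sf i : \sum_(p : {perm 'I_n} | p^-1%g j == i) f p = (n.-1`!)%:R * cell f i j.
  by rewrite -sum_fiber_f; apply: eq_bigl => p; rewrite inv_eq.
apply: le_trans (round_symdiff_le (key := fun p : {perm 'I_n} => p^-1%g j) s1 sf) _.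
by apply: (@round_bound (cell f ^~ j) (b ^~ j)) => [x|]; [apply: cell_coef | apply: bc].
Qed.

(* [e] is the squared distance of [f] to the span of the T_ij, [W'] the total mass of the matrix
   [b ^+ 2], and [T] its mass on pairs of entries in distinct rows and columns. *)
Lemma stability_data : exists e W' T : R,
  [/\ 0 <= e, W' / n.-1%:R = c * (1 - c) - e,
      n%:R * ((n`!)%:R * (W' / n.-1%:R)) + (n.-1 * 2)%:R * ((n`!)%:R * e) <= #|boundary_edges A|%:R,
      T <= (64 * 352) * n%:R ^+ 2 * e + 256 * (W' ^+ 2 / n%:R) &
      8 <= W' -> 2 * T <= W' ^+ 2 -> exists B M,
        [/\ dictatorship B, W' - 9 * (T / W') - 1 <= M &
            #|symdiff A B|%:R <= 4 * ((n`!)%:R * (c * (1 - c) - M / n.-1%:R))]].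
Proof.
have F0 := fact_gt0 n.
have E0 : 0 <= E by apply: sumr_ge0 => p _; apply: sqr_ge0.
have EF : E = (n`!)%:R * (E / (n`!)%:R) by rewrite mulrC divfK // gt_eqF.
exists (E / (n`!)%:R), W, (theta (fun i j => b i j ^+ 2)); split.
- by rewrite divr_ge0 // ltW.
- exact: pythagoras.
- by rewrite -EF; apply: energy.
- have W_le : W <= n%:R.
    have W4 : W / n.-1%:R <= 1.
      rewrite pythagoras; have : 0 <= E / (n`!)%:R by rewrite divr_ge0 // ltW.
      by have /andP[c0 c1] := c01; nra.
    rewrite ler_pdivrMr // mul1r in W4; apply: le_trans W4 _.
    by rewrite ler_nat leq_pred.
  have := theta_le br bc n_ge5 A c W_le.
  have -> : \sum_(p : {perm 'I_n}) ((p \in A)%:R - (c + diagsum b p)) ^+ 2 = E.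
    by apply: eq_bigr => p _; rewrite /rest -/b -/c /f /indic opprD addrA.
  move=> H; rewrite -(ler_pM2l F0); apply: le_trans H _.
  have dist (a u v w : R) : a * (u * v + 256 * w) = u * (a * v) + 256 * (a * w) by ring.
  by rewrite dist -EF.
move=> W8 TW; case: (theta_concentrated b2_le1 (erefl _) W8 TW) => -[i Wi].
  have [B [Bd Bs]] := row_dictatorship i.
  by exists B, (\sum_j b i j ^+ 2).
have [B [Bd Bs]] := col_dictatorship i.
by exists B, (\sum_k b k i ^+ 2).
Qed.

Lemma mean_indic : #|A|%:R = (n`!)%:R * c. Proof. exact: card_A. Qed.

End Main.

End LevelOne.

(** * Numerical estimates *)

Import LevelOne Rstruct.
Delimit Scope ring_scope with Ri.
Open Scope R_scope.

Lemma div_mul_cancel (a b : R) : b <> 0 -> a / b * b = a. Proof. intros; field; assumption. Qed.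

(** Here [N] is [n], [k] is [c(1-c)], [V] is [W / (n-1)], [y] is the seventh root of [c * delta0]
    and [z] the inverse cube root of [n]. The assumption [10000000 * (y + z) < k] selects the case
    where the claimed bound is nontrivial; it makes [e] small against [k ^ 2] and [N * k] large. *)
Lemma stability_numeric (N k e V W T y z : R) :
  5 <= N -> 0 < k -> k <= 1/4 -> 0 <= e -> 3 * e <= 5 * y ^ 7 -> V = k - e -> W = (N - 1) * V ->
  T <= 64 * 352 * N ^ 2 * e + 256 * (W ^ 2 / N) -> 0 <= y -> 0 <= z -> z ^ 3 * N = 1 ->
  10000000 * (y + z) < k ->
  8 <= W /\ 2 * T <= W ^ 2 /\
  forall M, W - 9 * (T / W) - 1 <= M -> 4 * (k - M / (N - 1)) <= 10000000 / k * (y + z).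
Proof.
intros N5 k0 k4 e0 ey VE WE TE y0 z0 zN Cyz.
assert (y1 : y <= 1) by lra.
assert (z1 : z <= 1) by lra.
assert (y2 : 0 <= y ^ 2 <= y) by (split; nra).
assert (y72 : y ^ 7 <= y ^ 2).
{ assert (0 <= y ^ 5 <= 1).
  { split; [apply pow_le; assumption|]. rewrite <- (pow1 5). apply pow_incr; lra. }
  replace (y ^ 7) with (y ^ 2 * y ^ 5) by ring. nra. }
assert (x0 : 0 <= z ^ 3) by (apply pow_le; assumption).
assert (xz : z ^ 3 <= z).
{ assert (0 <= z ^ 2 <= 1) by (split; nra). replace (z ^ 3) with (z * z ^ 2) by ring. nra. }
set (x := z ^ 3) in *.
assert (yk : y <= k / 10000000) by lra.
assert (yyk : y ^ 2 <= k / 10000000 * y) by nra.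
assert (yykk : y ^ 2 <= k / 10000000 * (k / 10000000)) by nra.
assert (e2 : 3 * e <= 5 * y ^ 2) by lra.
assert (ey1 : 3 * e <= 5 * y) by lra.
assert (eV : k / 2 <= V) by lra.
assert (V0 : 0 < V) by lra.
assert (Vk : V <= k) by lra.
assert (N0 : 0 < N) by lra.
assert (N1 : 0 < N - 1) by lra.
assert (NN : 4 / 5 * N <= N - 1) by lra.
assert (W25 : 2 / 5 * (N * k) <= W).
{ rewrite WE. assert (4 / 5 * N * (k / 2) <= (N - 1) * V) by (apply Rmult_le_compat; lra). lra. }
assert (Nk : 10000000 <= N * k).
{ assert (N * (10000000 * x) <= N * k) by (apply Rmult_le_compat_l; lra). lra. }
assert (W8 : 8 <= W) by lra.
assert (invN : / N = x).
{ apply Rmult_eq_reg_r with N; [|lra]. rewrite zN. field; lra. }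
assert (TE' : T <= 64 * 352 * (N ^ 2 * e) + 256 * (x * W ^ 2)).
{ eapply Rle_trans; [exact TE|]. rewrite <- invN. right; field; lra. }
assert (W2 : 4 / 25 * (N ^ 2 * k ^ 2) <= W ^ 2).
{ replace (4 / 25 * (N ^ 2 * k ^ 2)) with ((2 / 5 * (N * k)) ^ 2) by field.
  apply pow_incr. split; [|assumption]. nra. }
(* The first part of [T] is small because [e] is at most [5/3 * (k / 10000000) ^ 2] while [W ^ 2] is
   at least of order [N ^ 2 * k ^ 2]; the second because [x = 1 / N] is tiny. *)
assert (TW2 : 2 * T <= W ^ 2).
{ assert (x * W ^ 2 <= 1 / 2048 * W ^ 2) by (apply Rmult_le_compat_r; [apply pow2_ge_0|lra]).
  assert (N ^ 2 * e <= N ^ 2 * (5 / 3 * (k / 10000000 * (k / 10000000)))).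
  { apply Rmult_le_compat_l; [apply pow2_ge_0|lra]. }
  assert (0 <= N ^ 2 * k ^ 2) by (apply Rmult_le_pos; apply pow2_ge_0).
  replace (N ^ 2 * (5 / 3 * (k / 10000000 * (k / 10000000)))) with
    (5 / 3 / (10000000 * 10000000) * (N ^ 2 * k ^ 2)) in * by field.
  lra. }
split; [exact W8|]. split; [exact TW2|]. intros M WM.
assert (W0 : 0 < W) by lra.
assert (TW : T / W <= 64 * 352 * (N ^ 2 * e / W) + 256 * (x * W)).
{ replace (64 * 352 * (N ^ 2 * e / W) + 256 * (x * W)) with
    ((64 * 352 * (N ^ 2 * e) + 256 * (x * W ^ 2)) / W) by (field; lra).
  apply Rmult_le_compat_r; [|exact TE']. left; apply Rinv_0_lt_compat; exact W0. }
assert (ek0 : 0 <= e / k).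
{ apply Rmult_le_pos; [exact e0|]. left; apply Rinv_0_lt_compat; exact k0. }
(* The constant is 25/16 * 2: [N / (N - 1) <= 5/4] squared, and [V >= k / 2]. *)
assert (t1 : N ^ 2 * e / W <= 25 / 8 * (e / k) * (N - 1)).
{ apply Rmult_le_reg_r with W; [exact W0|]. rewrite div_mul_cancel; last lra. rewrite WE.
  assert (NN2 : N ^ 2 <= 25 / 16 * (N - 1) ^ 2) by nra.
  assert (eEk : e = e / k * k) by (field; lra).
  assert (ekV : e <= 2 * (e / k * V)) by nra.
  assert (N ^ 2 * e <= 25 / 16 * (N - 1) ^ 2 * (2 * (e / k * V))).
  { apply Rmult_le_compat; try assumption. apply pow2_ge_0. }
  lra. }
assert (t2 : x * W <= x / 4 * (N - 1)).
{ rewrite WE. assert (x * (N - 1) * V <= x * (N - 1) * (1 / 4)).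
  { apply Rmult_le_compat_l; [apply Rmult_le_pos; lra|lra]. } lra. }
assert (t3 : 1 <= 5 / 4 * x * (N - 1)).
{ assert (x * (4 / 5 * N) <= x * (N - 1)) by (apply Rmult_le_compat_l; lra). lra. }
(* Division by [N - 1] of the lower bound on [M]; [t3] charges the additive loss 1 to [x]. *)
assert (M1 : V - (9 * (64 * 352 * (25 / 8 * (e / k)) + 256 * (x / 4)) + 5 / 4 * x) <= M / (N - 1)).
{ apply Rmult_le_reg_r with (N - 1); [exact N1|]. rewrite div_mul_cancel; last lra.
  lra. }
assert (e4 : e <= e / k).
{ assert (eEk : e = e / k * k) by (field; lra). nra. }
assert (eyk : e / k <= 5 / 3 * (y / k)).
{ apply Rmult_le_reg_r with k; [exact k0|]. rewrite div_mul_cancel; last lra.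
  replace (5 / 3 * (y / k) * k) with (5 / 3 * y) by (field; lra). lra. }
assert (zk : z <= z / k).
{ apply Rmult_le_reg_r with k; [exact k0|]. rewrite div_mul_cancel; last lra. nra. }
assert (yk0 : 0 <= y / k).
{ apply Rmult_le_pos; [exact y0|]. left; apply Rinv_0_lt_compat; exact k0. }
replace (10000000 / k * (y + z)) with (10000000 * (y / k) + 10000000 * (z / k)) by (field; lra).
lra.
Qed.

Lemma IZR_natr (a : nat) : IZR (Z.of_nat a) = (a%:R)%Ri.
Proof. by rewrite -INRE INR_IZR_INZ. Qed.

(** A transfer of [stability_data] to the operations and numerals of the standard reals; [n.-1]
    becomes [INR n - 1], and [c] is identified with the mean through the size of [A]. *)
Lemma stability_data_Rdefinitions (n : nat) (A : {set {perm 'I_n}}) (c : R) :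
  (5 <= n)%N -> INR #|A| = c * INR n`! ->
  exists e W T : R, [/\ 0 <= e, W / (INR n - 1) = c * (1 - c) - e,
    INR n * (INR n`! * (W / (INR n - 1))) + (INR n - 1) * 2 * (INR n`! * e) <= INR #|boundary_edges A|,
    T <= 64 * 352 * INR n ^ 2 * e + 256 * (W ^ 2 / INR n) &
    8 <= W -> 2 * T <= W ^ 2 -> exists B M, [/\ dictatorship B, W - 9 * (T / W) - 1 <= M &
      INR #|symdiff A B| <= 4 * (INR n`! * (c * (1 - c) - M / (INR n - 1)))]].
Proof.
move=> n5 cA.
have F0 : INR n`! <> 0 by apply: not_0_INR; apply/eqP; rewrite -lt0n fact_gt0.
have cE : mean (indic R A) = c.
  apply: (Rmult_eq_reg_r (INR n`!)) => //; rewrite -cA (INRE #|A|) (mean_indic R A).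
  by rewrite INRE GRing.mulrC.
have n1E : INR n - 1 = (n.-1%:R)%Ri.
  by rewrite -INRE -{1}(prednK (ltn_trans (isT : 0 < 4)%N n5)) S_INR; ring.
have c2 : 2 = (2%:R)%Ri := IZR_natr 2. have c4 : 4 = (4%:R)%Ri := IZR_natr 4.
have c8 : 8 = (8%:R)%Ri := IZR_natr 8. have c9 : 9 = (9%:R)%Ri := IZR_natr 9.
have c64 : 64 = (64%:R)%Ri := IZR_natr 64. have c352 : 352 = (352%:R)%Ri := IZR_natr 352.
have c256 : 256 = (256%:R)%Ri := IZR_natr 256.
have [e [W [T]]] := @stability_data R n A n5; rewrite cE => -[e0 VE en TE last].
exists e, W, T; split.
- exact: (elimT RleP e0).
- by rewrite n1E.
- apply/RleP; move: en; rewrite GRing.natrM n1E c2 !(RplusE, RmultE, RminusE, RdivE, INRE).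
  by [].
- by apply/RleP; rewrite c64 c352 c256 !(RplusE, RmultE, RminusE, RdivE, INRE, RpowE).
move=> /RleP W8 /RleP TW; have [||B [M [Bd MW Bs]]] := last.
- by move: W8; rewrite c8.
- by move: TW; rewrite c2 RmultE RpowE.
exists B, M; split=> //.
  by apply/RleP; rewrite c9 !(RplusE, RmultE, RminusE, RdivE, INRE).
by apply/RleP; rewrite n1E c4 !(RplusE, RmultE, RminusE, RdivE, INRE).
Qed.

(** * Real powers and the concluding case analysis *)

Lemma rpow_ge0 (x a : R) : 0 <= rpow x a.
Proof. by rewrite /rpow; case: (Rle_dec x 0) => ?; [exact: Rle_refl | left; apply: exp_pos]. Qed.

(** At [x = 0] the identity rests on the default value 0 of [rpow] and on [m > 0]. *)
Lemma rpow_root (x a : R) (m : nat) : 0 <= x -> a * INR m = 1 -> (0 < m)%N -> rpow x a ^ m = x.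
Proof.
move=> x0 am m0; rewrite /rpow; case: (Rle_dec x 0) => [xle|xgt].
  by rewrite pow_i; [lra | apply/ltP].
by rewrite -Rpower_pow; [rewrite Rpower_mult am Rpower_1; lra | apply: exp_pos].
Qed.

Lemma dictatorship0 n : dictatorship (set0 : {set {perm 'I_n}}).
Proof. by exists set0; split=> [p q|]; rewrite ?inE // big_set0. Qed.

Theorem theorem4p4 :
  exists C : R, 0 < C /\
  forall (n : nat) (A : {set {perm 'I_n}}) (c delta0 : R),
    INR #|A| = c * INR (n`!)%N ->
    0 < c < 1 ->
    0 <= delta0 ->
    INR #|boundary_edges A| <= (1 - c + delta0) * INR n * INR #|A| ->
    exists B : {set {perm 'I_n}},
      dictatorship B /\
      INR #|symdiff A B| / INR (n`!)%N
        <= C / (c * (1 - c)) * (rpow (c * delta0) (1 / 7) + 1 / rpow (INR n) (1 / 3)).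
Proof.
exists 10000000; split; first lra.
move=> n A c d cA [c0 c1] d0 bd.
have F0 : 0 < INR n`! by apply: lt_0_INR; apply/ltP; rewrite fact_gt0.
(* For [n = 0] the size of [A] would be [c], strictly between 0 and 1. *)
have n0 : (0 < n)%N.
  rewrite lt0n; apply/eqP => nz; have : INR #|A| = c.
    by rewrite cA (_ : n`! = 1)%N ?nz //=; ring.
  case: #|A| => [/= | m]; first by lra.
  by rewrite S_INR; have := pos_INR m; lra.
have N0 : 0 < INR n by apply: lt_0_INR; apply/ltP.
set k := c * (1 - c); set y := rpow _ _; set z := 1 / _.
have k0 : 0 < k by apply: Rmult_lt_0_compat; lra.
have k4 : k <= 1 / 4 by have := pow2_ge_0 (c - 1 / 2); rewrite /k; lra.
have y0 : 0 <= y := rpow_ge0 _ _.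
have cd0 : 0 <= c * d by apply: Rmult_le_pos; lra.
have y7 : y ^ 7 = c * d by apply: rpow_root => //; rewrite /=; field.
have rn3 : rpow (INR n) (1 / 3) ^ 3 = INR n by apply: rpow_root => //; [lra | rewrite /=; field].
have rn0 : 0 < rpow (INR n) (1 / 3).
  case: (rpow_ge0 (INR n) (1 / 3)) => // E; move: rn3; rewrite -E /=; lra.
have z0 : 0 <= z by left; apply: Rdiv_lt_0_compat; lra.
have zN : z ^ 3 * INR n = 1 by rewrite /z; move: (rpow _ _) rn3 rn0 => r <- r0; field; lra.
(* If [k <= 10000000 * (y + z)] the claimed bound is at least 1, and the empty dictatorship, at
   distance [c], already meets it. *)
case: (Rle_lt_dec k (10000000 * (y + z))) => [triv|yz].
  exists set0; split; first exact: dictatorship0.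
  have -> : symdiff A set0 = A by apply/setP => p; rewrite /symdiff !inE andbF orbF.
  have -> : INR #|A| / INR n`! = c by rewrite cA; field; lra.
  apply: (Rmult_le_reg_r k) => //.
  have -> : 10000000 / k * (y + z) * k = 10000000 * (y + z) by field; lra.
  have h : c * k <= 1 * k by apply: Rmult_le_compat_r; lra.
  by lra.
(* In the remaining case [z] is below 1/10, whereas [z ^ 3 * n = 1] with [n <= 4] would force
   [z ^ 3 >= 1/4]. *)
have n5 : (5 <= n)%N.
  rewrite leqNgt; apply/negP => n4.
  have nR : INR n <= 4 by have := le_INR n 4 (elimT (@leP n 4) n4); rewrite /=; lra.
  have z1 : z <= 1 / 10 by lra.
  have : z ^ 3 <= (1 / 10) ^ 3 by apply: pow_incr.
  move: zN; move: (z ^ 3) (pow_le z 3 z0) => x x0 xN xs; nra.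
have N5 : 5 <= INR n by have := le_INR 5 n (elimT (@leP 5 n) n5); rewrite /=; lra.
have [e [W [T [e0 VE en TE last]]]] := stability_data_Rdefinitions n5 cA.
rewrite -/k in VE last; rewrite VE in en.
(* Comparing the energy bound with the boundary hypothesis cancels the main term [n * k] and leaves
   [(n - 2) * e <= n * c * delta0]; for [n >= 5] the ratio [n / (n - 2)] is at most 5/3. *)
have ey : 3 * e <= 5 * y ^ 7.
  rewrite y7; rewrite cA in bd.
  have h : INR n`! * (INR n * (k - e) + (INR n - 1) * 2 * e) <=
      INR n`! * ((1 - c + d) * INR n * c) by lra.
  have {}h := Rmult_le_reg_l _ _ _ F0 h.
  have h2 : (INR n - 2) * e <= INR n * (c * d) by rewrite /k in h; lra.
  have h3 : (INR n - 2) * (3 * e) <= (INR n - 2) * (5 * (c * d)).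
    by have : 5 * (c * d) <= INR n * (c * d); [apply: Rmult_le_compat_r | lra].
  by apply: (Rmult_le_reg_l (INR n - 2)) => //; lra.
have WE : W = (INR n - 1) * (k - e) by rewrite -VE; field; lra.
have [W8 [TW concl]] := stability_numeric N5 k0 k4 e0 ey (erefl _) WE TE y0 z0 zN yz.
have [B [M [Bd MW Bs]]] := last W8 TW.
exists B; split=> //; apply: Rle_trans (concl M MW).
apply: (Rmult_le_reg_r (INR n`!)) => //.
by rewrite /Rdiv Rmult_assoc Rinv_l ?Rmult_1_r; lra.
Qed.
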